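(* Let $n\ge3$, let $k\ge1$ be an integer and let $1\le l\le n-1$. For fixed $u,v\in\mathbb{R}^n$ consider, for $x\in\mathbb{R}^n\setminus\mathbb{Z}^l$, the series $$\mathrm{Cot}_{l,k}(x,u,v)=\sum_{\mathbf{m}\in\mathbb{Z}^l}H_k(x+\mathbf{m},u,v)\qquad\text{if }1\le l\le n-2,$$ $$\mathrm{Cot}_{n-1,k}(x,u,v)=H_k(x,u,v)+\sum_{\mathbf{m}\in\Lambda_{n-1}}\big[H_k(x+\mathbf{m},u,v)+H_k(x-\mathbf{m},u,v)\big]\qquad\text{if }l=n-1 .$$ Then the series converges uniformly in $x$ on compact subsets of $\mathbb{R}^n\setminus\mathbb{Z}^l$. Its sum is $l$-fold periodic, i.e. $\mathrm{Cot}_{l,k}(x+\mathbf{m},u,v)=\mathrm{Cot}_{l,k}(x,u,v)$ for all $\mathbf{m}\in\mathbb{Z}^l$, so that $\mathrm{Cot}'_{l,k}(x',y',u,v):=\mathrm{Cot}_{l,k}(x-y,u,v)$, with $x'=\pi_l(x)$, $y'=\pi_l(y)$, is well defined for $(x',y')\in C_l\times C_l$ with $x'\ne y'$. For each fixed $y'\in C_l$ and $v\in\mathbb{R}^n$, it satisfies $$Q_k^{C_l}\mathrm{Cot}'_{l,k}(x',y',u,v)=0\qquad\text{for }x'\in C_l\setminus\{y'\},$$ where $Q_k^{C_l}$ acts in the variables $(x',u)$.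
   Context: $Cl_n$ is the real Clifford algebra generated by $\mathbb{R}^n$ with $x^2=-\|x\|^2$ for $x\in\mathbb{R}^n$; $e_1,\dots,e_n$ is the standard orthonormal basis. The Dirac operator is $D=\sum_{j=1}^n e_j\partial/\partial x_j$. $\mathcal{M}_k$ is the space of $Cl_n$-valued polynomials $p(u)$ on $\mathbb{R}^n$, homogeneous of degree $k$, with $D_up=0$ (left monogenic). $\mathcal{H}_k$ is the space of $Cl_n$-valued harmonic polynomials homogeneous of degree $k$; $\mathcal{H}_k=\mathcal{M}_k\oplus u\mathcal{M}_{k-1}$, $P_k:\mathcal{H}_k\to\mathcal{M}_k$ is the corresponding projection and $I-P_k:\mathcal{H}_k\to u\mathcal{M}_{k-1}$. For $g(x,u)$ with $g(x,\cdot)\in\mathcal{M}_{k-1}$, the remaining Rarita–Schwinger operator is $Q_k\,ug(x,u)=(I-P_k)D_x\,ug(x,u)$. $Z_{k-1}(u,v)$ is the reproducing kernel of $\mathcal{M}_{k-1}$: the unique $Cl_n$-valued polynomial, homogeneous of degree $k-1$ in each of $u,v$, left monogenic in $u$, right monogenic in $v$, with $p(u)=\int_{\mathbb{S}^{n-1}}Z_{k-1}(u,v)p(v)\,dS(v)$ for all $p\in\mathcal{M}_{k-1}$ ($dS$ the unnormalized surface measure). With $\omega_n$ the area of $\mathbb{S}^{n-1}$ and $c_k=\frac{n-2}{n-2+2k}$, $$H_k(x,u,v)=\frac{-1}{\omega_nc_k}\,u\,\frac{x}{\|x\|^n}\,Z_{k-1}\Big(\frac{xux}{\|x\|^2},v\Big)\,v,\qquad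 x\neq0 .$$ $\mathbb{Z}^l=\mathbb{Z}e_1+\cdots+\mathbb{Z}e_l$, $C_l=\mathbb{R}^n/\mathbb{Z}^l$, $\pi_l:\mathbb{R}^n\to C_l$ the projection. $\Lambda_{l}=\bigcup_{j=1}^{l}\{m_1e_1+\cdots+m_je_j:m_i\in\mathbb{Z},\,m_j>0\}$, so $\mathbb{Z}^l\setminus\{0\}=\Lambda_l\sqcup(-\Lambda_l)$. For $g'(x',u)$ on $U'\times\mathbb{R}^n$, $U'\subset C_l$ open, with $g'(x',\cdot)\in\mathcal{M}_{k-1}$ and lift $g(x,u)=g'(\pi_l(x),u)$, $Q_k^{C_l}ug'$ is the function on $U'\times\mathbb{R}^n$ whose lift is $Q_kug$. *)

(* Defs.v *)
From HB Require Import structures.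
From mathcomp Require Import all_boot all_order all_algebra finmap.
From mathcomp Require Import generic_quotient.
From mathcomp Require Import all_classical all_reals all_analysis.
From mathcomp Require summability.

Set Implicit Arguments.
Unset Strict Implicit.
Unset Printing Implicit Defensive.

Import Order.TTheory GRing.Theory Num.Theory.
Import numFieldNormedType.Exports.

Local Open Scope classical_set_scope.
Local Open Scope ring_scope.

(* The real Clifford algebra with basis e_A (A a set of indices), where e_A is *)
(* the product of the e_i, i \in A, in increasing order.  A row vector is used *)
(* as the carrier so that the normed-space structure is the library's.         *)
Section Clifford.
Variables (R : realType) (n : nat).

Definition Cl : Type := 'rV[R]_#|{set 'I_n}|.

HB.instance Definition _ := NormedModule.on Cl.

Definition clcoef (a : Cl) (A : {set 'I_n}) : R := a 0 (enum_rank A).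
Definition clbasis (A : {set 'I_n}) : Cl := delta_mx 0 (enum_rank A).

Definition symdiff (A B : {set 'I_n}) : {set 'I_n} :=
  [set i | (i \in A) (+) (i \in B)]%SET.

(* e_A e_B = clsign A B *: e_(A symdiff B): one sign for each transposition    *)
(* e_i e_j = - e_j e_i (j < i) and one for each contraction e_i e_i = -1.      *)
Definition clsign (A B : {set 'I_n}) : R :=
  \prod_(i < n) \prod_(j < n | (j <= i)%N) (-1) ^+ ((i \in A) && (j \in B)).

Definition clmul (a b : Cl) : Cl :=
  \sum_(A : {set 'I_n}) \sum_(B : {set 'I_n})
    (clcoef a A * clcoef b B * clsign A B) *: clbasis (symdiff A B).

Definition cl1 : Cl := clbasis finset.set0.

Lemma cl_expand (a : Cl) : a = \sum_A clcoef a A *: clbasis A.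
Proof.
rewrite [LHS]row_sum_delta (reindex_onto enum_rank enum_val) /=; last first.
  by move=> i _; rewrite enum_valK.
by apply: eq_big => [i|i _] //; rewrite enum_rankK eqxx.
Qed.

Lemma clcoef_basis A B : clcoef (clbasis A) B = (A == B)%:R.
Proof.
by rewrite /clcoef /clbasis mxE eqxx (inj_eq enum_rank_inj) eq_sym.
Qed.

Lemma clcoefD a b A : clcoef (a + b) A = clcoef a A + clcoef b A.
Proof. by rewrite /clcoef mxE. Qed.

Lemma clcoefZ k a A : clcoef (k *: a) A = k * clcoef a A.
Proof. by rewrite /clcoef mxE. Qed.

Lemma clmulDl : left_distributive clmul +%R.
Proof.
move=> a b c; rewrite /clmul -big_split; apply: eq_bigr => A _.
rewrite -big_split; apply: eq_bigr => B _.
by rewrite clcoefD !mulrDl scalerDl.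
Qed.

Lemma clmulDr : right_distributive clmul +%R.
Proof.
move=> a b c; rewrite /clmul -big_split; apply: eq_bigr => A _.
rewrite -big_split; apply: eq_bigr => B _.
by rewrite clcoefD mulrDr !mulrDl scalerDl.
Qed.

Lemma clmulZl k a b : clmul (k *: a) b = k *: clmul a b.
Proof.
rewrite /clmul scaler_sumr; apply: eq_bigr => A _.
rewrite scaler_sumr; apply: eq_bigr => B _.
by rewrite clcoefZ scalerA !mulrA.
Qed.

Lemma clmulZr k a b : clmul a (k *: b) = k *: clmul a b.
Proof.
rewrite /clmul scaler_sumr; apply: eq_bigr => A _.
rewrite scaler_sumr; apply: eq_bigr => B _.
by rewrite clcoefZ scalerA !mulrA [clcoef a A * k]mulrC.
Qed.

Lemma clmul0l b : clmul 0 b = 0.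
Proof. by have := clmulZl 0 0 b; rewrite !scale0r. Qed.

Lemma clmul0r b : clmul b 0 = 0.
Proof. by have := clmulZr 0 b 0; rewrite !scale0r. Qed.

Lemma cl_ext (f g : Cl -> Cl) :
    {morph f : a b / a + b} -> {morph g : a b / a + b} ->
    (forall k, {morph f : a / k *: a}) -> (forall k, {morph g : a / k *: a}) ->
  (forall A, f (clbasis A) = g (clbasis A)) -> f =1 g.
Proof.
move=> fD gD fZ gZ fg a.
have f0 : f 0 = 0 by have := fZ 0 0; rewrite !scale0r.
have g0 : g 0 = 0 by have := gZ 0 0; rewrite !scale0r.
rewrite (cl_expand a) (big_morph f fD f0) (big_morph g gD g0).
by apply: eq_bigr => A _; rewrite fZ gZ fg.
Qed.

Lemma clmul_basis A B :
  clmul (clbasis A) (clbasis B) = clsign A B *: clbasis (symdiff A B).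
Proof.
rewrite /clmul (bigD1 A) //= [X in _ + X]big1 ?addr0; last first.
  move=> C; rewrite eq_sym => /negPf CA; rewrite big1// => D _.
  by rewrite clcoef_basis CA !mul0r scale0r.
rewrite (bigD1 B) //= [X in _ + X]big1 ?addr0; last first.
  move=> C; rewrite eq_sym => /negPf CA.
  by rewrite !clcoef_basis CA mulr0 mul0r scale0r.
by rewrite !clcoef_basis !eqxx !mul1r.
Qed.

Lemma symdiffA : associative symdiff.
Proof. by move=> A B C; apply/finset.setP => i; rewrite !inE addbA. Qed.

Lemma clsignDl A B C : clsign (symdiff A B) C = clsign A C * clsign B C.
Proof.
rewrite /clsign -big_split; apply: eq_bigr => i _.
rewrite -big_split; apply: eq_bigr => j _; rewrite inE.
by case: (i \in A); case: (i \in B); case: (j \in C);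
  rewrite /= ?expr0 ?expr1 ?mulr1 ?mul1r ?mulrNN ?mulr1.
Qed.

Lemma clsignDr A B C : clsign A (symdiff B C) = clsign A B * clsign A C.
Proof.
rewrite /clsign -big_split; apply: eq_bigr => i _.
rewrite -big_split; apply: eq_bigr => j _; rewrite inE.
by case: (i \in A); case: (j \in B); case: (j \in C);
  rewrite /= ?expr0 ?expr1 ?mulr1 ?mul1r ?mulrNN ?mulr1.
Qed.

Lemma clmulA : associative clmul.
Proof.
move=> a b c; move: a.
apply: (cl_ext (f := fun a => clmul a (clmul b c))
               (g := fun a => clmul (clmul a b) c)).
- by move=> a a'; exact: clmulDl.
- by move=> a a'; rewrite (clmulDl a a' b); exact: clmulDl.
- by move=> k a; exact: clmulZl.
- by move=> k a; rewrite (clmulZl k a b); exact: clmulZl.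
move=> A; move: b.
apply: (cl_ext (f := fun b => clmul (clbasis A) (clmul b c))
               (g := fun b => clmul (clmul (clbasis A) b) c)).
- by move=> b b'; rewrite (clmulDl b b' c); exact: clmulDr.
- by move=> b b'; rewrite (clmulDr (clbasis A) b b'); exact: clmulDl.
- by move=> k b; rewrite (clmulZl k b c); exact: clmulZr.
- by move=> k b; rewrite (clmulZr k (clbasis A) b); exact: clmulZl.
move=> B; move: c.
apply: (cl_ext (f := fun c => clmul (clbasis A) (clmul (clbasis B) c))
               (g := clmul (clmul (clbasis A) (clbasis B)))).
- by move=> c c'; rewrite (clmulDr (clbasis B) c c'); exact: clmulDr.
- by move=> c c'; exact: clmulDr.
- by move=> k c; rewrite (clmulZr k (clbasis B) c); exact: clmulZr.
- by move=> k c; exact: clmulZr.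
move=> C; rewrite !clmul_basis clmulZr clmulZl !clmul_basis !scalerA.
by rewrite symdiffA clsignDl clsignDr mulrC -!mulrA.
Qed.

Lemma clmul1l : left_id cl1 clmul.
Proof.
apply: (cl_ext (f := clmul cl1) (g := id)) => // [a b|k a|A]; [exact: clmulDr | exact: clmulZr |].
rewrite clmul_basis /clsign big1 ?scale1r; last first.
  by move=> i _; rewrite big1// => j _; rewrite inE.
by congr clbasis; apply/finset.setP => i; rewrite !inE.
Qed.

Lemma clmul1r : right_id cl1 clmul.
Proof.
apply: (cl_ext (f := fun a => clmul a cl1)) => // [a b|k a|A];
  [exact: clmulDl | exact: clmulZl |].
rewrite clmul_basis /clsign big1 ?scale1r; last first.
  by move=> i _; rewrite big1// => j _; rewrite inE andbF.
by congr clbasis; apply/finset.setP => i; rewrite !inE addbF.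
Qed.

Lemma cl1_neq0 : cl1 != 0.
Proof.
apply/eqP => /(congr1 (fun a => clcoef a finset.set0)).
rewrite clcoef_basis eqxx /clcoef mxE => /eqP.
by rewrite oner_eq0.
Qed.

HB.instance Definition _ := GRing.Zmodule_isNzRing.Build Cl
  clmulA clmul1l clmul1r clmulDl clmulDr cl1_neq0.
HB.instance Definition _ := GRing.Lmodule_isLalgebra.Build R Cl
  (fun k a b => esym (clmulZl k a b)).
HB.instance Definition _ := GRing.Lalgebra_isAlgebra.Build R Cl
  (fun k a b => esym (clmulZr k a b)).

Definition stdvec (j : nat) : 'rV[R]_n := \row_(i < n) (i == j :> nat)%:R.

Definition clgen (j : 'I_n) : Cl := clbasis [set j]%SET.
Definition clvec (x : 'rV[R]_n) : Cl := \sum_(j < n) x 0 j *: clgen j.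
Definition vecpart (a : Cl) : 'rV[R]_n := \row_j clcoef a [set j]%SET.

Definition dotp (x y : 'rV[R]_n) : R := \sum_(j < n) x 0 j * y 0 j.
(* The library norm on 'rV[R]_n is the sup norm, hence this definition. *)
Definition enorm (x : 'rV[R]_n) : R := Num.sqrt (dotp x x).

Lemma vecpartK x : vecpart (clvec x) = x.
Proof.
apply/rowP => i; rewrite mxE /clvec /clcoef summxE (bigD1 i) //= big1 ?addr0.
  by rewrite mxE [clgen i _ _]clcoef_basis eqxx mulr1.
move=> j /negPf ji; rewrite mxE [clgen j _ _]clcoef_basis.
by rewrite (inj_eq set1_inj) ji mulr0.
Qed.

Lemma clgen_sqr j : clgen j * clgen j = -1.
Proof.
rewrite -[LHS]/(clmul _ _) clmul_basis -[RHS]scaleN1r; congr (_ *: _).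
  rewrite /clsign (bigD1 j) //= [X in _ * X]big1 ?mulr1; last first.
    by move=> i /negPf ij; rewrite big1// => i' _; rewrite inE ij.
  rewrite (bigD1 j) //= [X in _ * X]big1 ?mulr1 ?inE ?eqxx//.
  by move=> i /andP[_ /negPf ij]; rewrite !inE ij andbF.
by congr clbasis; apply/finset.setP => i; rewrite !inE addbb.
Qed.

Lemma clgen_anti i j : i != j -> clgen i * clgen j = - (clgen j * clgen i).
Proof.
have sg a b : clsign [set a]%SET [set b]%SET = (-1) ^+ (b <= a)%N.
  rewrite /clsign (bigD1 a) //= [X in _ * X]big1 ?mulr1; last first.
    by move=> c /negPf ca; rewrite big1// => c' _; rewrite inE ca.
  have [ba|ba] := boolP (b <= a)%N.
    rewrite (bigD1 b) //= [X in _ * X]big1 ?mulr1 ?inE ?eqxx//.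
    by move=> c /andP[_ /negPf cb]; rewrite !inE cb andbF.
  rewrite big1// => c ca; rewrite !inE eqxx.
  by have [cb|//] := eqVneq c b; rewrite -cb ca in ba.
move=> ij; rewrite -[LHS]/(clmul _ _) -[X in _ = - X]/(clmul _ _) !clmul_basis.
have -> : symdiff [set j]%SET [set i]%SET = symdiff [set i]%SET [set j]%SET.
  by apply/finset.setP => a; rewrite !inE addbC.
rewrite -scaleNr; congr (_ *: _); rewrite !sg.
have : (i : nat) != j by [].
by rewrite neq_ltn => /orP[] h; rewrite (ltnW h) leqNgt h ?opprK.
Qed.

Lemma clvec_anticomm x y :
  clvec x * clvec y + clvec y * clvec x = - (dotp x y *+ 2)%:A.
Proof.
rewrite /clvec !mulr_suml; under eq_bigr do rewrite mulr_sumr.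
under [X in _ + X]eq_bigr do rewrite mulr_sumr.
rewrite [X in _ + X]exchange_big /= -big_split /= /dotp.
transitivity (\sum_(i < n) - (x 0 i * y 0 i *+ 2)%:A : Cl).
  apply: eq_bigr => i _; rewrite -big_split /= (bigD1 i) //= big1 ?addr0.
    rewrite -!scalerAl -!scalerAr !scalerA clgen_sqr [y 0 i * _]mulrC.
    by rewrite -scalerDl scalerN mulr2n.
  move=> j ji; rewrite -!scalerAl -!scalerAr !scalerA (clgen_anti ji).
  by rewrite [y 0 j * _]mulrC scalerN subrr.
by rewrite sumrN -scaler_suml sumrMnl.
Qed.

Lemma clvec_sqr x : clvec x * clvec x = - (enorm x ^+ 2)%:A.
Proof.
have d0 : 0 <= dotp x x by apply: sumr_ge0 => i _; exact: sqr_ge0.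
rewrite /enorm sqr_sqrtr//.
have /(congr1 (fun a => 2^-1 *: a)) := clvec_anticomm x x.
rewrite scalerDr -scalerDl -[2^-1 + _]mulr2n -[2^-1 *+ 2]mulr_natr.
rewrite mulVf ?pnatr_eq0// scale1r => ->.
by rewrite scalerN scalerA -[dotp x x *+ 2]mulr_natl mulKf ?pnatr_eq0.
Qed.

Lemma clvec_sandwich x u :
  clvec x * clvec u * clvec x =
  clvec (vecpart (clvec x * clvec u * clvec x)).
Proof.
have vD (a b : 'rV[R]_n) : clvec (a + b) = clvec a + clvec b.
  by rewrite /clvec -big_split; apply: eq_bigr => i _; rewrite mxE scalerDl.
have vZ k (a : 'rV[R]_n) : clvec (k *: a) = k *: clvec a.
  by rewrite /clvec scaler_sumr; apply: eq_bigr => i _; rewrite mxE scalerA.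
suff -> : clvec x * clvec u * clvec x =
    clvec ((enorm x ^+ 2) *: u + (- (dotp x u *+ 2)) *: x).
  by rewrite vecpartK.
have -> : clvec x * clvec u = - (dotp x u *+ 2)%:A - clvec u * clvec x.
  by rewrite -clvec_anticomm addrK.
rewrite mulrBl -mulrA clvec_sqr mulrN opprK mulNr -!scalerAl mul1r.
by rewrite -scalerAr mulr1 vD !vZ scaleNr addrC.
Qed.

Definition dirac (f : 'rV[R]_n -> Cl) (x : 'rV[R]_n) : Cl :=
  \sum_(j < n) clgen j * 'D_(stdvec j) f x.

Definition dirac_right (f : 'rV[R]_n -> Cl) (x : 'rV[R]_n) : Cl :=
  \sum_(j < n) 'D_(stdvec j) f x * clgen j.

End Clifford.

Section Polynomials.
Variables (R : realType) (n : nat).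
Local Notation V := 'rV[R]_n.
Local Notation C := (Cl R n).

Definition mdeg k (a : {ffun 'I_n -> 'I_k.+1}) : nat := (\sum_(i < n) a i)%N.
Definition monom k (a : {ffun 'I_n -> 'I_k.+1}) (u : V) : R :=
  \prod_(i < n) u 0 i ^+ a i.

Definition hpoly (k : nat) (p : V -> C) : Prop :=
  exists c : {ffun 'I_n -> 'I_k.+1} -> C,
    forall u, p u = \sum_(a | mdeg a == k) monom a u *: c a.

Definition bihpoly (k : nat) (p : V -> V -> C) : Prop :=
  exists c : {ffun 'I_n -> 'I_k.+1} -> {ffun 'I_n -> 'I_k.+1} -> C,
    forall u v, p u v = \sum_(a | mdeg a == k) \sum_(b | mdeg b == k)
      (monom a u * monom b v) *: c a b.

Definition monogenic_poly (k : nat) (p : V -> C) : Prop :=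
  hpoly k p /\ forall u, dirac p u = 0.

Definition umonogenic_poly (k : nat) (w : V -> C) : Prop :=
  exists2 q, monogenic_poly k q & forall u, w u = clvec u * q u.

(* P_k h is the M_k-component of h along H_k = M_k (+) u M_(k-1), where H_k is *)
(* the space of harmonic polynomials; the default 0 is taken only outside H_k. *)
Definition fischerP (k : nat) (h : V -> C) : V -> C :=
  xget (fun=> 0) [set p | monogenic_poly k p /\
    umonogenic_poly k.-1 (fun u => h u - p u)].

(* Q_k on a function F(x, u) with F(x, _) in u M_(k-1) *)
Definition RSQ (k : nat) (F : V -> V -> C) (x u : V) : C :=
  let DF := fun w => dirac (fun y => F y w) x in DF u - fischerP k DF u.

End Polynomials.

Section Sphere.
Variable R : realType.

(* n-fold iterated Lebesgue integral *)
Fixpoint lebesgue_int (n : nat) : ('rV[R]_n -> R) -> R :=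
  if n is n'.+1 then fun f =>
    \int[@lebesgue_measure R]_t
      lebesgue_int (fun y : 'rV[R]_n' => f (row_mx (t%:M : 'rV[R]_1) y))
  else fun f => f 0.

(* The surface measure of A is n times the volume of the cone over A, so the   *)
(* integral over the sphere is n times the integral over the unit ball of the  *)
(* extension of f that is constant on rays.                                    *)
Definition sphere_int (n : nat) (f : 'rV[R]_n -> R) : R :=
  n%:R * lebesgue_int (fun x : 'rV[R]_n =>
    if (0 < enorm x <= 1) then f ((enorm x)^-1 *: x) else 0).

Definition sphere_area (n : nat) : R := sphere_int (fun _ : 'rV[R]_n => 1).

Definition sphere_Clint (n : nat) (f : 'rV[R]_n -> Cl R n) : Cl R n :=
  \sum_A sphere_int (fun v => clcoef (f v) A) *: clbasis R A.

End Sphere.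

Section Kernels.
Variables (R : realType) (n : nat).
Local Notation V := 'rV[R]_n.
Local Notation C := (Cl R n).

Definition is_reproducing_kernel (k : nat) (Z : V -> V -> C) : Prop :=
  [/\ bihpoly k Z,
      forall u v, dirac (fun w => Z w v) u = 0,
      forall u v, dirac_right (Z u) v = 0 &
      forall p, monogenic_poly k p ->
        forall u, p u = sphere_Clint (fun v => Z u v * p v)].

Definition rs_const (k : nat) : R := (n%:R - 2) / (n%:R - 2 + 2 * k%:R).

(* Z stands for Z_(k-1) *)
Definition RSH (k : nat) (Z : V -> V -> C) (x u v : V) : C :=
  (- 1 / (sphere_area R n * rs_const k)) *:
    (clvec u * ((enorm x ^+ n)^-1 *: clvec x) *
     Z (vecpart ((enorm x ^+ 2)^-1 *: (clvec x * clvec u * clvec x))) v *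
     clvec v).

End Kernels.

Section Cylinder.
Variables (R : realType) (n l : nat).
Local Notation V := 'rV[R]_n.

Definition latt (m : 'rV[int]_l) : V := \sum_(j < l) (m 0 j)%:~R *: stdvec R n j.

Definition lattice : set V := range latt.

Definition half_lattice (m : 'rV[int]_l) : bool :=
  [exists j, (0 < m 0 j) && [forall i : 'I_l, (j < i)%N ==> (m 0 i == 0)]].

Lemma lattD m1 m2 : latt (m1 + m2) = latt m1 + latt m2.
Proof.
by rewrite /latt -big_split; apply: eq_bigr => j _; rewrite mxE rmorphD scalerDl.
Qed.

Lemma lattN m : latt (- m) = - latt m.
Proof.
by rewrite /latt -sumrN; apply: eq_bigr => j _; rewrite mxE rmorphN scaleNr.
Qed.

Definition lattice_eq (x y : V) : bool := `[< lattice (x - y) >].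

Lemma lattice_eq_refl : reflexive lattice_eq.
Proof.
move=> x; apply/asboolP; exists 0 => //; rewrite subrr.
by rewrite /latt big1// => j _; rewrite mxE scale0r.
Qed.

Lemma lattice_eq_sym : symmetric lattice_eq.
Proof.
move=> x y; apply: asbool_equiv_eq.
by split=> -[m _ mE]; exists (- m) => //; rewrite lattN mE opprB.
Qed.

Lemma lattice_eq_trans : transitive lattice_eq.
Proof.
move=> y x z /asboolP[m1 _ m1E] /asboolP[m2 _ m2E]; apply/asboolP.
by exists (m1 + m2) => //; rewrite lattD m1E m2E addrA subrK.
Qed.

Canonical lattice_eq_equiv :=
  EquivRel lattice_eq lattice_eq_refl lattice_eq_sym lattice_eq_trans.

Definition cylinder : Type := {eq_quot lattice_eq}%qT.
HB.instance Definition _ := EqQuotient.on cylinder.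
HB.instance Definition _ := Choice.on cylinder.

Definition cyl_pi (x : V) : cylinder := (\pi_cylinder x)%qT.

Lemma cyl_piP x y : cyl_pi x = cyl_pi y <-> lattice (x - y).
Proof.
split=> [/eqP|h]; first by rewrite [_ == _]eqmodE => /asboolP.
by apply/eqP; rewrite [_ == _]eqmodE; apply/asboolP.
Qed.

(* Q_k on the cylinder, computed on the lift; cylRSQ_pi shows that the choice  *)
(* of representative does not matter.                                          *)
Definition cylRSQ (k : nat) (F : cylinder -> V -> Cl R n) (x' : cylinder) (u : V)
    : Cl R n :=
  RSQ k (fun x => F (cyl_pi x)) (repr x') u.

Lemma cylRSQ_pi k F x u :
  cylRSQ k F (cyl_pi x) u = RSQ k (fun y => F (cyl_pi y)) x u.
Proof.
have [m _ xE] : lattice (repr (cyl_pi x) - x).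
  by apply/cyl_piP; rewrite {1}/cyl_pi reprK.
have dE w : dirac (fun y => F (cyl_pi y) w) (repr (cyl_pi x)) =
            dirac (fun y => F (cyl_pi y) w) x.
  apply: eq_bigr => j _; congr (_ * _); rewrite /derive.
  have per y : cyl_pi (y + repr (cyl_pi x)) = cyl_pi (y + x).
    by apply/cyl_piP; exists m => //; rewrite opprD addrACA subrr add0r.
  have per0 : cyl_pi (repr (cyl_pi x)) = cyl_pi x by rewrite {1}/cyl_pi reprK.
  by under eq_fun do rewrite /= /shift /= per per0.
rewrite /cylRSQ /RSQ dE; congr (_ - fischerP k _ u).
by apply/funext => w; exact: dE.
Qed.

End Cylinder.

Section Cotangent.
Variables (R : realType) (n l k : nat).
Local Notation V := 'rV[R]_n.
Local Notation C := (Cl R n).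
Variable Z : V -> V -> C.

Definition cot_psum (S : {fset 'rV[int]_l}) (x u v : V) : C :=
  if (l <= n - 2)%N then \sum_(m <- S) RSH k Z (x + latt R n m) u v
  else RSH k Z x u v +
    \sum_(m <- S | half_lattice m)
      (RSH k Z (x + latt R n m) u v + RSH k Z (x - latt R n m) u v).

(* sum of the series along the directed set of finite sets of indices *)
Definition cot (x u v : V) : C :=
  lim (cot_psum S x u v @[S --> summability.totally]).

End Cotangent.

Arguments lattice R n l : clear implicits.
Arguments latt R n {l} m.
Arguments cyl_pi {R n} l x.
Arguments cot {R n} l k Z x u v.

(* Main.v *)
(* Write w = x u x / |x|^2, the reflection of u, f(w) = c Z(w, v) v and         *)
(* G(x, u) = |x|^(-n) x f(w), so that H_k = u G.  For fixed x, G is monogenic   *)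
(* in u by conformal invariance, and a direct computation gives D_x G = u q     *)
(* with q = -2 |x|^(-n-2) x (x . grad f)(w), where D_u q = 0; hence             *)
(* D_u (u h) = -2 h for h = D_x G.  As D_x (u G) = - u h - 2 <u, grad_x> G and  *)
(* D_u <u, grad_x> G = h, it follows that D_u D_x (u G) = 2 h - 2 h = 0, that   *)
(* is, D_x H_k is in M_k and Q_k H_k = 0.  All these conditions on polynomials  *)
(* in u are closed under pointwise limits, so they pass to the cotangent        *)
(* series.  In x, G is odd, homogeneous of degree 1 - n and locally Lipschitz;  *)
(* thus the terms of the series (paired when l = n - 1) and their difference    *)
(* quotients are O(|m|^(-l-1)), which is summable over Z^l.                     *)

Require Import Defs.
From HB Require Import structures.
From mathcomp Require Import all_boot all_order all_algebra finmap.
From mathcomp Require Import all_classical all_reals all_analysis.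
From mathcomp Require Import ring lra zify.
From mathcomp Require summability.

Set Implicit Arguments.
Unset Strict Implicit.
Unset Printing Implicit Defensive.

Import Order.TTheory GRing.Theory Num.Theory.
Import numFieldNormedType.Exports.
Local Open Scope classical_set_scope.
Local Open Scope ring_scope.

(* The analysis library exports a measure of the same name. *)
Local Notation dirac := Defs.dirac.

(** Every term of the series is [clvec u] times [refl_kernel p] (the G above) with p = c Z(., v) v;
    see [RSHE]. The left factor u does not depend on x, so all the analysis is done on the series of
    G, with sum [cotk], and u is put back in [cotE].

    Convergence. [refl_kernel_bounds] gives |G(y)| = O(|y|^(1-n)) and increments O(|h| |y|^(-n)).
    For l <= n - 2 the first bound is summable over Z^l. For l = n - 1 it just fails to be, but
    oddness turns G(x+m) + G(x-m) into a difference of two increments, of size O(|m|^(-n)).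
    [lterm_bounds] covers both cases, together with differences in x, by the summable weight
    |m|^(-l-1); the finitely many terms near the singularities are left unestimated. The finite sums
    therefore converge uniformly for bounded x ([lterm_uniform]), and the series may be
    differentiated term by term ([is_derive_usum]).

    Periodicity. The paired series cannot simply be reindexed by a translation. Over symmetric
    boxes, however, the pairing can be undone ([fsum_box]), and translating a box alters the sum
    only on a boundary layer whose contribution tends to 0 ([sum_box_gap]).

    The equation. The Fischer sum is direct, so Q_k F = 0 once D_x F lies in M_k
    ([fischerP_monogenic]). [monogenic_dirac_clvecM] obtains this from two facts: G is monogenic in
    u, and D_x G satisfies [dirac_eigen]. Both hold for a single term ([monogenic_refl_kernel],
    [dirac_eigen_refl_kernel]). They survive the summation because homogeneous polynomials of a
    fixed degree form a finite-dimensional space, where pointwise limits carry the coefficients,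
    hence the Dirac operator, along ([hpoly_lim], [dirac_lim]). *)

(** * Limits and directional derivatives of bilinear expressions *)

Section BilinearCalculus.
Variables (R : realType) (U W X V : normedModType R).
Variables (B : U -> W -> X) (K : R).
Hypothesis Bsubl : forall a a' b, B (a - a') b = B a b - B a' b.
Hypothesis Bsubr : forall a b b', B a (b - b') = B a b - B a b'.
Hypothesis Bscalel : forall k a b, B (k *: a) b = k *: B a b.
Hypothesis Bscaler : forall k a b, B a (k *: b) = k *: B a b.
Hypothesis K0 : 0 <= K.
Hypothesis Bnorm : forall a b, `|B a b| <= K * (`|a| * `|b|).

Lemma bilin_cvg (T : Type) (F : set_system T) (FF : Filter F)
    (f : T -> U) (g : T -> W) a b :
  f @ F --> a -> g @ F --> b -> (fun t => B (f t) (g t)) @ F --> B a b.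
Proof.
move=> fa gb; apply/cvgrPdist_le => e e0.
(* With both errors at most [e / L], the total error is at most [e / L * (L - 1)], hence below [e];
   the final [+ 1] keeps [L] positive when [K] is 0. *)
pose L := K * (`|a| + `|b| + 1) + 1.
have L0 : 0 < L by rewrite /L ltr_wpDl// mulr_ge0// !addr_ge0.
have d0 : 0 < e / L by rewrite divr_gt0.
near=> t.
have fd : `|a - f t| <= e / L by near: t; exact: cvgr_dist_le fa _ d0.
have gd : `|b - g t| <= e / L by near: t; exact: cvgr_dist_le gb _ d0.
have g1 : `|b - g t| <= 1 by near: t; exact: cvgr_dist_le gb _ ltr01.
have -> : B a b - B (f t) (g t) = B (a - f t) (g t) + B a (b - g t).
  by rewrite Bsubl Bsubr [RHS]addrC addrA subrK.
have gL : `|g t| <= `|b| + 1.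
  by rewrite -[g t](subKr b) (le_trans (ler_normB _ _))// lerD2l.
apply: (le_trans (ler_normD _ _)).
apply: (le_trans (lerD (Bnorm _ _) (Bnorm _ _))).
rewrite -mulrDr; apply: (@le_trans _ _ (K * (e / L * (`|b| + 1) + `|a| * (e / L)))).
  by apply: ler_wpM2l => //; apply: lerD; apply: ler_pM.
have -> : K * (e / L * (`|b| + 1) + `|a| * (e / L)) = e / L * (L - 1).
  by rewrite /L; ring.
by rewrite mulrBr mulr1 divfK ?gt_eqF// gerBl ltW.
Unshelve. all: by end_near. Qed.

(** A directional derivative gives continuity along its line only. This is all that the product rule
    below needs, so total differentiability is never assumed. *)
Lemma is_derive_line_cvg (Y : normedModType R) (f : V -> Y) x v df :
  is_derive x v f df -> (fun h : R => f (h *: v + x)) @ 0^' --> f x.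
Proof.
move=> [/derivable1P/derivable1_diffP/differentiable_continuous fc _].
have : (fun h : R => f (h *: v + x)) @ (0 : R) --> f (0 *: v + x) by exact: fc.
rewrite scale0r add0r.
by apply: cvg_trans; apply: cvg_app; exact: nbhs_dnbhs.
Qed.

Lemma is_derive_bilin (f : V -> U) (g : V -> W) x v df dg :
  is_derive x v f df -> is_derive x v g dg ->
  is_derive x v (fun y => B (f y) (g y)) (B df (g x) + B (f x) dg).
Proof.
move=> fD gD.
suff cv : (fun h : R => h^-1 *: (((fun y => B (f y) (g y)) \o shift x) (h *: v)
    - B (f x) (g x))) @ 0^' --> B df (g x) + B (f x) dg.
  by apply: DeriveDef; [apply/cvg_ex; eexists; exact: cv|exact: (cvg_lim _ cv)].
have -> : (fun h : R => h^-1 *: (((fun y => B (f y) (g y)) \o shift x) (h *: v)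
    - B (f x) (g x))) = (fun h : R =>
   B (h^-1 *: (f (h *: v + x) - f x)) (g (h *: v + x)) +
   B (f x) (h^-1 *: (g (h *: v + x) - g x))).
  apply/funext => h; rewrite Bscalel Bscaler -scalerDr Bsubl Bsubr /=.
  by congr (_ *: _); rewrite addrA subrK.
apply: cvgD; apply: bilin_cvg.
- by case: fD => fd <-; exact: fd.
- exact: is_derive_line_cvg gD.
- exact: cvg_cst.
- by case: gD => gd <-; exact: gd.
Qed.

End BilinearCalculus.

(** * Continuity of the Clifford product *)

Section CliffordCalculus.
Variables (R : realType) (n : nat).
Local Notation V := 'rV[R]_n.
Local Notation C := (Cl R n).
Implicit Types a b c : C.

Lemma clcoef_sum (I : Type) (r : seq I) (P : pred I) (F : I -> C) A :
  clcoef (\sum_(i <- r | P i) F i) A = \sum_(i <- r | P i) clcoef (F i) A.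
Proof. by rewrite /clcoef summxE. Qed.

Lemma normr_clcoef a A : `|clcoef a A| <= `|a|.
Proof.
rewrite /clcoef [leRHS]/Num.Def.normr/= mx_normrE.
exact: (le_bigmax _ (fun i => `|a i.1 i.2|) (0, enum_rank A)).
Qed.

Lemma cl_normr_le a e : 0 <= e -> (forall A, `|clcoef a A| <= e) -> `|a| <= e.
Proof.
move=> e0 ae; rewrite /Num.Def.normr/= mx_normrE (bigmax_le _ e0)// => -[i j] _ /=.
by have := ae (enum_val j); rewrite /clcoef enum_valK (ord1 i).
Qed.

(** The number of pairs of basis elements, a crude bound for the product in the sup norm of the
    coefficients. *)
Definition clmulK : R := (\sum_(A : {set 'I_n}) \sum_(B : {set 'I_n}) 1).

Lemma clmulK_ge0 : 0 <= clmulK.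
Proof. by apply: sumr_ge0 => A _; apply: sumr_ge0. Qed.

Lemma normr_clsign (A B : {set 'I_n}) : `|clsign R A B| = 1.
Proof.
rewrite /clsign normr_prod big1// => i _; rewrite normr_prod big1// => j _.
by rewrite normrX normrN1 expr1n.
Qed.

Lemma cl_normrM a b : `|a * b| <= clmulK * (`|a| * `|b|).
Proof.
apply: cl_normr_le => [|D]; first by rewrite mulr_ge0 ?clmulK_ge0// mulr_ge0.
rewrite -[a * b]/(clmul a b) /clmul clcoef_sum.
apply: (le_trans (ler_norm_sum _ _ _)); rewrite /clmulK mulr_suml.
apply: ler_sum => A _; rewrite clcoef_sum.
apply: (le_trans (ler_norm_sum _ _ _)); rewrite mulr_suml.
apply: ler_sum => B _; rewrite clcoefZ clcoef_basis !normrM normr_clsign mulr1 mul1r.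
have ab : `|clcoef a A| * `|clcoef b B| <= `|a| * `|b|.
  by apply: ler_pM => //; exact: normr_clcoef.
by case: (_ == _); rewrite ?normr1 ?normr0 ?mulr1 ?mulr0// mulr_ge0.
Qed.

Lemma cl_cvgM (T : Type) (F : set_system T) (FF : Filter F) (f g : T -> C) a b :
  f @ F --> a -> g @ F --> b -> (fun t => f t * g t) @ F --> a * b.
Proof.
apply: (bilin_cvg (B := fun a b => a * b) _ _ clmulK_ge0 cl_normrM).
- by move=> *; exact: mulrBl.
- by move=> *; exact: mulrBr.
Qed.

Lemma cl_is_deriveM (f g : V -> C) x v df dg :
  is_derive x v f df -> is_derive x v g dg ->
  is_derive x v (fun y => f y * g y) (df * g x + f x * dg).
Proof.
apply: (is_derive_bilin (B := fun a b => a * b) _ _ _ _ clmulK_ge0 cl_normrM).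
- by move=> *; exact: mulrBl.
- by move=> *; exact: mulrBr.
- by move=> *; rewrite scalerAl.
- by move=> *; rewrite scalerAr.
Qed.

End CliffordCalculus.

Lemma is_derive_scale (R : realType) (V W : normedModType R) (f : V -> R)
    (g : V -> W) x v df dg :
  is_derive x v f df -> is_derive x v g dg ->
  is_derive x v (fun y => f y *: g y) (df *: g x + f x *: dg).
Proof.
apply: (@is_derive_bilin R R W W V (fun a b => a *: b) 1) => //.
- by move=> *; rewrite scalerBl.
- by move=> *; rewrite scalerBr.
- by move=> k a b; rewrite scalerA.
- by move=> k a b; rewrite !scalerA mulrC.
- by move=> a b; rewrite mul1r normrZ.
Qed.

Lemma is_derive_translate (R : realType) (V' W : normedModType R) (f : V' -> W) x v z df :
  is_derive (x + z) v f df -> is_derive x v (fun y => f (y + z)) df.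
Proof.
have e : (fun t : R => t^-1 *: (((fun y => f (y + z)) \o shift x) (t *: v) - f (x + z))) =
     (fun t : R => t^-1 *: ((f \o shift (x + z)) (t *: v) - f (x + z))).
  by apply/funext => t /=; rewrite addrA.
by move=> [d1 d2]; apply: DeriveDef; rewrite /derivable /derive ?e.
Qed.

Lemma cvg_line (R : realType) (V : normedModType R) (x v : V) :
  (fun t : R => t *: v + x) @ (0 : R) --> x.
Proof.
rewrite -[X in _ --> X]add0r -(scale0r v); apply: cvgD; last exact: cvg_cst.
by apply: cvgZ; [exact: cvg_id|exact: cvg_cst].
Qed.

(** * Partial derivatives of Clifford-valued polynomials *)

Section PolynomialFunctions.
Variables (R : realType) (n : nat).
Local Notation V := 'rV[R]_n.
Local Notation C := (Cl R n).

(** Unlike in [monom], the exponents are arbitrary naturals, so that raising or lowering one of them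
    stays within the same class. *)
Definition gmon (b : 'I_n -> nat) (u : V) : R := \prod_(i < n) u 0 i ^+ b i.
(** The truncation [0.-1 = 0] is harmless: in [dgmon] the factor [(b j)%:R] then vanishes. *)
Definition bdec (j : 'I_n) (b : 'I_n -> nat) (i : 'I_n) : nat :=
  if i == j then (b i).-1 else b i.
Definition dgmon (j : 'I_n) (b : 'I_n -> nat) (u : V) : R :=
  (b j)%:R * gmon (bdec j b) u.

Lemma is_derive_bigsum (V' W : normedModType R) (I : Type) (r : seq I) (P : pred I)
    (f : I -> V' -> W) (df : I -> W) x v :
  (forall i, P i -> is_derive x v (f i) (df i)) ->
  is_derive x v (fun y => \sum_(i <- r | P i) f i y) (\sum_(i <- r | P i) df i).
Proof.
move=> fd; elim: r => [|i r IH].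
  under eq_fun do rewrite big_nil; rewrite big_nil; exact: is_derive_cst.
under eq_fun do rewrite big_cons; rewrite big_cons; case: ifPn => // Pi.
exact: is_deriveD (fd i Pi) IH.
Qed.

Lemma is_derive_bigprod (V' : normedModType R) (I : eqType) (r : seq I)
    (f : I -> V' -> R) (df : I -> R) x v :
  uniq r -> (forall i, is_derive x v (f i) (df i)) ->
  is_derive x v (fun y => \prod_(i <- r) f i y)
    (\sum_(i <- r) df i * \prod_(j <- r | j != i) f j x).
Proof.
move=> + fd; elim: r => [_|i r IH /= /andP[ir ur]].
  under eq_fun do rewrite big_nil; rewrite big_nil; exact: is_derive_cst.
under eq_fun do rewrite big_cons.
have := is_derive_scale (fd i) (IH ur).
congr is_derive; rewrite big_cons; congr (_ + _).
  rewrite big_cons eqxx /= /GRing.scale/=; congr (_ * _).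
  rewrite [RHS]big_seq_cond [LHS]big_seq; apply: eq_bigl => j.
  by have [->|//] := eqVneq j i; rewrite ?(negPf ir) ?andbT.
rewrite /GRing.scale/= mulr_sumr [LHS]big_seq [RHS]big_seq; apply: eq_bigr => j jr.
rewrite big_cons; case: eqVneq => [ij|_] /=; first by rewrite ij jr in ir.
by rewrite mulrCA.
Qed.

Lemma is_derive_gmon (V' : normedModType R) (b : 'I_n -> nat) (w : V' -> V)
    (dw : 'I_n -> R) x v :
  (forall i, is_derive x v (fun y => w y 0 i) (dw i)) ->
  is_derive x v (fun y => gmon b (w y)) (\sum_i dw i * dgmon i b (w x)).
Proof.
move=> wd; have fd i : is_derive x v (fun y => w y 0 i ^+ b i)
    ((b i)%:R * w x 0 i ^+ (b i).-1 * dw i).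
  case: (b i) => [|m].
    by under eq_fun do rewrite expr0; rewrite !mul0r; exact: is_derive_cst.
  have := @is_deriveX R V' (fun y => w y 0 i) m.+1 x v (dw i) (wd i).
  by congr is_derive; apply/funext => y; rewrite fctE.
have := is_derive_bigprod (index_enum_uniq _) fd.
congr is_derive; apply: eq_bigr => i _.
rewrite /dgmon /gmon [in RHS](bigD1 i)//= /bdec eqxx.
rewrite [_ * dw i]mulrC -!mulrA; congr (_ * (_ * (_ * _))).
by apply: eq_bigr => j /negPf ->.
Qed.

Section Family.
Variables (I : finType) (P : pred I) (b : I -> 'I_n -> nat) (c : I -> C).

Definition polyf (u : V) : C := \sum_(i | P i) gmon (b i) u *: c i.
Definition dpolyf (j : 'I_n) (u : V) : C := \sum_(i | P i) dgmon j (b i) u *: c i.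

(** A chain rule for any inner map with derivable coordinates; it serves for the reflection both as
    a function of u and as a function of x. *)
Lemma is_derive_polyf (V' : normedModType R) (w : V' -> V) (dw : 'I_n -> R) x v :
  (forall i, is_derive x v (fun y => w y 0 i) (dw i)) ->
  is_derive x v (fun y => polyf (w y)) (\sum_j dw j *: dpolyf j (w x)).
Proof.
move=> wd; have := @is_derive_bigsum V' C I (index_enum _) P
  (fun i y => gmon (b i) (w y) *: c i)
  (fun i => (\sum_j dw j * dgmon j (b i) (w x)) *: c i) x v.
have fd i : P i -> is_derive x v (fun y => gmon (b i) (w y) *: c i)
    ((\sum_j dw j * dgmon j (b i) (w x)) *: c i).
  move=> _; have := is_derive_scale (is_derive_gmon (b i) wd) (is_derive_cst (c i) x v).
  by congr is_derive; rewrite scaler0 addr0.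
move=> /(_ fd); congr is_derive.
under eq_bigr do rewrite scaler_suml.
rewrite exchange_big /=; apply: eq_bigr => j _; rewrite scaler_sumr.
by apply: eq_bigr => i _; rewrite scalerA.
Qed.

End Family.

Lemma is_derive_coord (x v : V) i : is_derive x v (fun y : V => y 0 i) (v 0 i).
Proof.
have d : derivable (id : V -> V) x v by exact: derivable_id.
have := @derive_mx R V 1 n id x v d; rewrite derive_id => /matrixP/(_ 0 i); rewrite mxE => ->.
by apply: derivableP; exact: ((@derivable_mxP R V 1 n id x v).1 d 0 i).
Qed.

Lemma derive_polyf (I : finType) (P : pred I) b (c : I -> C) (j : 'I_n) (u : V) :
  is_derive u (stdvec R n j) (polyf P b c) (dpolyf P b c j u).
Proof.
have := @is_derive_polyf I P b c V id _ u (stdvec R n j) (is_derive_coord u _).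
congr is_derive; rewrite (bigD1 j)//= big1 ?addr0 ?mxE ?eqxx ?scale1r// => i ij.
by rewrite mxE -val_eqE in ij *; rewrite (negPf ij) scale0r.
Qed.

Lemma dpolyfE (I : finType) (P : pred I) b (c : I -> C) j :
  dpolyf P b c j = polyf P (fun i => bdec j (b i)) (fun i => (b i j)%:R *: c i).
Proof.
apply/funext => u; apply: eq_bigr => i _.
by rewrite /dgmon scalerA mulrC.
Qed.

(** Symmetry of second partial derivatives, read off the exponents and not deduced from an analytic
    theorem. *)
Lemma dpolyfC (I : finType) (P : pred I) (b : I -> 'I_n -> nat) (c : I -> C) j j' u :
  dpolyf P (fun i => bdec j (b i)) (fun i => (b i j)%:R *: c i) j' u =
  dpolyf P (fun i => bdec j' (b i)) (fun i => (b i j')%:R *: c i) j u.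
Proof.
have [->//|jj] := eqVneq j j'.
apply: eq_bigr => i _; rewrite /dgmon !scalerA; congr (_ *: _).
have -> : bdec j (b i) j' = b i j' by rewrite /bdec eq_sym (negPf jj).
have -> : bdec j' (b i) j = b i j by rewrite /bdec (negPf jj).
rewrite mulrAC [RHS]mulrAC [_%:R * _]mulrC; congr (_ * _).
apply: eq_bigr => m _; congr (_ ^+ _); rewrite /bdec.
by case: (m == j); case: (m == j').
Qed.

End PolynomialFunctions.

(** * Homogeneous polynomials and their pointwise limits *)

Section HomogeneousPolynomials.
Variables (R : realType) (n : nat).
Local Notation V := 'rV[R]_n.
Local Notation C := (Cl R n).
Local Notation expo k := {ffun 'I_n -> 'I_k.+1}.
Implicit Types (p q : V -> C).

Lemma hpolyP k p : hpoly k p -> exists c : expo k -> C,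
  p = polyf (fun a => mdeg a == k) (fun a i => a i : nat) c.
Proof. by move=> [c pE]; exists c; apply/funext => u; rewrite pE. Qed.

Lemma hpolyD k p q : hpoly k p -> hpoly k q -> hpoly k (fun u => p u + q u).
Proof.
move=> [c pE] [d qE]; exists (fun a => c a + d a) => u.
by rewrite pE qE -big_split /=; apply: eq_bigr => a _; rewrite scalerDr.
Qed.

Lemma hpolyZ k (t : R) p : hpoly k p -> hpoly k (fun u => t *: p u).
Proof.
move=> [c pE]; exists (fun a => t *: c a) => u.
rewrite pE scaler_sumr; apply: eq_bigr => a _.
by rewrite !scalerA [t * _]mulrC.
Qed.

Lemma hpoly0 k : hpoly k (fun _ : V => 0 : C).
Proof. by exists (fun=> 0) => u; rewrite big1// => a _; rewrite scaler0. Qed.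

Lemma hpoly_sum k (I : Type) (r : seq I) (P : pred I) (p : I -> V -> C) :
  (forall i, P i -> hpoly k (p i)) -> hpoly k (fun u => \sum_(i <- r | P i) p i u).
Proof.
move=> hp; elim: r => [|i r IH].
  by under eq_fun do rewrite big_nil; exact: hpoly0.
under eq_fun do rewrite big_cons; case: (boolP (P i)) => // Pi.
exact: hpolyD (hp i Pi) IH.
Qed.

Lemma hpoly_mull k (a : C) p : hpoly k p -> hpoly k (fun u => a * p u).
Proof.
move=> [c pE]; exists (fun e => a * c e) => u.
by rewrite pE mulr_sumr; apply: eq_bigr => e _; rewrite -scalerAr.
Qed.

Lemma hpoly_mulr k (a : C) p : hpoly k p -> hpoly k (fun u => p u * a).
Proof.
move=> [c pE]; exists (fun e => c e * a) => u.
by rewrite pE mulr_suml; apply: eq_bigr => e _; rewrite -scalerAl.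
Qed.

Lemma hpoly_gmon (b : 'I_n -> nat) (c : C) :
  hpoly (\sum_i b i)%N (fun u => gmon b u *: c).
Proof.
set k := (\sum_i b i)%N.
have bk i : (b i < k.+1)%N by rewrite ltnS /k (bigD1 i)//= leq_addr.
pose a : expo k := [ffun i => Ordinal (bk i)].
exists (fun e => if e == a then c else 0) => u.
rewrite (bigD1 a)/=; last by rewrite /mdeg (eq_bigr b)// => i _; rewrite ffunE.
rewrite eqxx big1 ?addr0 => [|e /andP[_ /negPf ->]]; last by rewrite scaler0.
by congr (_ *: _); apply: eq_bigr => i _; rewrite ffunE.
Qed.

Lemma hpoly_coord k p (i : 'I_n) : hpoly k p -> hpoly k.+1 (fun u => u 0 i *: p u).
Proof.
move=> [c pE].
have -> : (fun u : V => u 0 i *: p u) = (fun u : V => \sum_(a : expo k | mdeg a == k)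
    gmon (fun j => a j + (j == i))%N u *: c a).
  apply/funext => u; rewrite pE scaler_sumr; apply: eq_bigr => a _.
  rewrite scalerA; congr (_ *: _); rewrite /monom /gmon.
  under [RHS]eq_bigr do rewrite exprD.
  rewrite big_split/= mulrC; congr (_ * _).
  rewrite (bigD1 i)//= eqxx expr1 big1 ?mulr1// => j /negPf ->.
  by rewrite expr0.
apply: hpoly_sum => a /eqP ak.
suff e : (\sum_j (a j + (j == i)))%N = k.+1.
  by have := hpoly_gmon (fun j => a j + (j == i))%N (c a); rewrite e.
rewrite big_split/= -[X in (X + _)%N]/(mdeg a) ak (bigD1 i)//= eqxx big1 ?addn0 ?addn1//.
by move=> j /negPf ->.
Qed.

Lemma hpoly_const (c : C) : hpoly 0 (fun _ : V => c).
Proof.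
have := hpoly_gmon (fun=> 0%N) c; rewrite big1//; congr hpoly.
by apply/funext => u; rewrite /gmon big1 ?scale1r// => i _; rewrite expr0.
Qed.

Lemma hpoly_clvec k p : hpoly k p -> hpoly k.+1 (fun u => clvec u * p u).
Proof.
move=> hp.
have -> : (fun u : V => clvec u * p u) = (fun u : V => \sum_(j < n) clgen R j * (u 0 j *: p u)).
  apply/funext => u; rewrite /clvec mulr_suml; apply: eq_bigr => j _.
  by rewrite -scalerAl scalerAr.
by apply: hpoly_sum => j _; apply: hpoly_mull; exact: hpoly_coord.
Qed.

(** A linear substitution turns each monomial into a product of linear forms, and multiplying by one
    linear form raises the degree by one. *)
Lemma hpoly_comp k p (w : V -> V) (A : 'M[R]_n) :
    (forall u i, w u 0 i = \sum_j A i j * u 0 j) ->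
  hpoly k p -> hpoly k (fun u => p (w u)).
Proof.
move=> wE [c pE].
have -> : (fun u : V => p (w u)) = (fun u : V => \sum_(a : expo k | mdeg a == k)
    monom a (w u) *: c a) by apply/funext => u; rewrite pE.
apply: hpoly_sum => a /eqP ak.
suff : hpoly (mdeg a) (fun u => monom a (w u) *: c a) by rewrite ak.
have lin m q i : hpoly m q -> hpoly m.+1 (fun u => w u 0 i *: q u).
  move=> hq.
  have -> : (fun u : V => w u 0 i *: q u) = (fun u => \sum_j A i j *: (u 0 j *: q u)).
    apply/funext => u; rewrite wE scaler_suml; apply: eq_bigr => j _.
    by rewrite scalerA.
  by apply: hpoly_sum => j _; apply: hpolyZ; exact: hpoly_coord.
suff prodP (s : seq 'I_n) (b : 'I_n -> nat) (d : C) :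
    hpoly (\sum_(i <- s) b i)%N (fun u => (\prod_(i <- s) w u 0 i ^+ b i) *: d).
  exact: prodP.
elim: s => [|i s IH].
  rewrite big_nil; have := hpoly_const d.
  by congr hpoly; apply/funext => u; rewrite big_nil scale1r.
rewrite big_cons.
suff : hpoly (b i + \sum_(j <- s) b j)
    (fun u => w u 0 i ^+ b i *: ((\prod_(j <- s) w u 0 j ^+ b j) *: d)).
  by congr hpoly; apply/funext => u; rewrite big_cons scalerA.
elim: (b i) => [|m IHm].
  by move: IH; congr hpoly; apply/funext => u; rewrite expr0 scale1r.
by have := lin _ _ i IHm; congr hpoly; apply/funext => u; rewrite scalerA exprS.
Qed.

Definition gridpt k (b : expo k) : V := \row_i (b i)%:R.

(** The inverse Vandermonde matrix at the nodes 0, ..., k recovers the coefficients of a polynomial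
    of degree at most k from its values there. *)
Lemma Vandermonde_dual k : exists L : 'I_k.+1 -> 'I_k.+1 -> R,
  forall j m : 'I_k.+1, \sum_i L j i * (i : nat)%:R ^+ m = (j == m)%:R.
Proof.
pose X := Vandermonde k.+1 (\row_(i < k.+1) ((i : nat)%:R : R)).
have Xu : X \in unitmx.
  rewrite unitmxE det_Vandermonde unitfE prodf_seq_neq0; apply/allP => i _ /=.
  rewrite prodf_seq_neq0; apply/allP => j _ /=; apply/implyP => ij.
  by rewrite !mxE subr_eq0 eqr_nat gtn_eqF.
exists (fun j i => invmx X i j) => j m.
have /matrixP/(_ m j) := mulmxV Xu; rewrite !mxE eq_sym => <-.
by apply: eq_bigr => i _; rewrite !mxE mulrC.
Qed.

(* Lagrange interpolation on the grid {0, ..., k}^n, with tensor products of   *)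
(* inverse Vandermonde matrices.  The coefficients become linear in finitely   *)
(* many values, so they and the Dirac operator pass to pointwise limits.       *)
Lemma hpoly_interpolation k : exists lam : expo k -> expo k -> R,
  forall p, hpoly k p -> p = polyf (fun a => mdeg a == k) (fun a i => a i : nat)
    (fun a => \sum_b lam a b *: p (gridpt b)).
Proof.
have [L LE] := Vandermonde_dual k.
exists (fun a b => \prod_i L (a i) (b i)) => p [c pE].
apply/funext => u; rewrite {1}pE; apply: eq_bigr => a ak; congr (_ *: _).
transitivity (\sum_(e : expo k | mdeg e == k) (a == e)%:R *: c e).
  rewrite (bigD1 a)//= eqxx scale1r big1 ?addr0// => e /andP[_ /negPf ea].
  by rewrite eq_sym ea scale0r.
under [RHS]eq_bigr do rewrite pE scaler_sumr.
rewrite exchange_big /=; apply: eq_bigr => e _.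
under eq_bigr do rewrite scalerA; rewrite -scaler_suml; congr (_ *: _).
rewrite /monom.
under [RHS]eq_bigr do rewrite -big_split/=.
under [RHS]eq_bigr do under eq_bigr do rewrite mxE.
rewrite -(bigA_distr_bigA (fun i j => L (a i) j * (j : nat)%:R ^+ e i)).
under [RHS]eq_bigr do rewrite LE.
have [<-|ae] := eqVneq a e; first by rewrite big1// => i _; rewrite eqxx.
have [i ai] : exists i, a i != e i.
  by apply/existsP; apply: contraNT ae; rewrite negb_exists => /forallP ae;
    apply/eqP/ffunP => i; apply/eqP; rewrite -[_ == _]negbK ae.
by rewrite (bigD1 i)//= (negPf ai) mul0r.
Qed.

Lemma cvgZr (W : normedModType R) (T : Type) (F : set_system T) (FF : Filter F)
    (t : R) (f : T -> W) (a : W) :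
  f @ F --> a -> (fun s => t *: f s) @ F --> t *: a.
Proof. by move=> fa; apply: cvgZ => //; exact: cvg_cst. Qed.

Lemma cvg_bigsum (W : normedModType R) (T : Type) (F : set_system T) (FF : Filter F)
    (I : Type) (r : seq I) (P : pred I) (f : I -> T -> W) (a : I -> W) :
  (forall i, P i -> f i @ F --> a i) ->
  (fun t => \sum_(i <- r | P i) f i t) @ F --> \sum_(i <- r | P i) a i.
Proof. by move=> fa; apply: cvg_big => //; exact: add_continuous. Qed.

Section Limits.
Variables (k : nat) (T : Type) (F : set_system T) (FF : ProperFilter F).
Variables (p : T -> V -> C) (q : V -> C).
Hypothesis hp : \forall t \near F, hpoly k (p t).
Hypothesis pq : forall u, (fun t => p t u) @ F --> q u.

(** The interpolation formula involves finitely many values, so it passes to the limit and exhibits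
    the coefficients of [q]. *)
Lemma hpoly_lim : hpoly k q.
Proof.
have [lam lamE] := hpoly_interpolation k.
exists (fun a => \sum_b lam a b *: q (gridpt b)) => u.
suff h : (fun t => p t u) @ F -->
    polyf (fun a => mdeg a == k) (fun a i => a i : nat)
    (fun a => \sum_b lam a b *: q (gridpt b)) u.
  exact: (cvg_unique (@norm_hausdorff R C) (@pq u) h).
have : (fun t => polyf (fun a => mdeg a == k) (fun a i => a i : nat)
    (fun a => \sum_b lam a b *: p t (gridpt b)) u) @ F -->
    polyf (fun a => mdeg a == k) (fun a i => a i : nat)
    (fun a => \sum_b lam a b *: q (gridpt b)) u.
  apply: cvg_bigsum => a _; apply: cvgZr; apply: cvg_bigsum => b _.
  by apply: cvgZr; exact: pq.
apply: cvg_trans; apply: near_eq_cvg; near=> t.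
have /lamE <- // : hpoly k (p t) by near: t.
Unshelve. all: by end_near. Qed.

Lemma dirac_lim u : (fun t => dirac (p t) u) @ F --> dirac q u.
Proof.
have [lam lamE] := hpoly_interpolation k.
have dE r : hpoly k r -> dirac r u = \sum_(j < n) clgen R j *
    dpolyf (fun a => mdeg a == k) (fun (a : expo k) i => a i : nat)
    (fun a => \sum_b lam a b *: r (gridpt b)) j u.
  move=> /lamE hr; rewrite {1}hr /dirac; apply: eq_bigr => j _; congr (_ * _).
  exact: (@derive_val _ _ _ _ _ _ _ (derive_polyf _ _ _ j u)).
rewrite dE; last exact: hpoly_lim.
have : (fun t => \sum_(j < n) clgen R j *
    dpolyf (fun a => mdeg a == k) (fun (a : expo k) i => a i : nat)
    (fun a => \sum_b lam a b *: p t (gridpt b)) j u) @ F --> \sum_(j < n) clgen R j *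
    dpolyf (fun a => mdeg a == k) (fun (a : expo k) i => a i : nat)
    (fun a => \sum_b lam a b *: q (gridpt b)) j u.
  apply: cvg_bigsum => j _; apply: cl_cvgM; first exact: cvg_cst.
  apply: cvg_bigsum => a _; apply: cvgZr; apply: cvg_bigsum => b _.
  by apply: cvgZr; exact: pq.
apply: cvg_trans; apply: near_eq_cvg; near=> t.
by rewrite -dE//; near: t.
Unshelve. all: by end_near. Qed.

End Limits.

End HomogeneousPolynomials.

(** * Vector identities in the Clifford algebra and derivatives of the Euclidean norm *)

Section CliffordVectors.
Variables (R : realType) (n : nat).
Local Notation V := 'rV[R]_n.
Local Notation C := (Cl R n).
Implicit Types (x y u v : V) (a : C).

Lemma clvecD x y : clvec (x + y) = clvec x + clvec y.
Proof. by rewrite /clvec -big_split; apply: eq_bigr => i _; rewrite mxE scalerDl. Qed.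

Lemma clvecZ k x : clvec (k *: x) = k *: clvec x.
Proof. by rewrite /clvec scaler_sumr; apply: eq_bigr => i _; rewrite mxE scalerA. Qed.

Lemma clvec_stdvec (j : 'I_n) : clvec (stdvec R n j) = clgen R j.
Proof.
rewrite /clvec (bigD1 j)//= mxE eqxx scale1r big1 ?addr0// => i ij.
by rewrite mxE -val_eqE in ij *; rewrite (negPf ij) scale0r.
Qed.

Lemma dotpC x y : dotp x y = dotp y x.
Proof. by apply: eq_bigr => i _; rewrite mulrC. Qed.

Lemma dotpZr k x y : dotp x (k *: y) = k * dotp x y.
Proof. by rewrite /dotp mulr_sumr; apply: eq_bigr => i _; rewrite mxE mulrCA. Qed.

Lemma dotp_stdvec (j : 'I_n) x : dotp x (stdvec R n j) = x 0 j.
Proof.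
rewrite /dotp (bigD1 j)//= mxE eqxx mulr1 big1 ?addr0// => i ij.
by rewrite mxE -val_eqE in ij *; rewrite (negPf ij) mulr0.
Qed.

Lemma dotp_ge0 x : 0 <= dotp x x.
Proof. by apply: sumr_ge0 => i _; exact: sqr_ge0. Qed.

Lemma dotp_eq0 x : (dotp x x == 0) = (x == 0).
Proof.
apply/idP/eqP => [|->]; last first.
  by rewrite /dotp big1// => i _; rewrite mxE mul0r.
rewrite /dotp psumr_eq0 => [/allP x0|i _]; last exact: sqr_ge0.
apply/rowP => i; rewrite mxE; apply/eqP.
by have := x0 i (mem_index_enum _); rewrite /= mulf_eq0 orbb.
Qed.

Lemma enorm_sqr x : enorm x ^+ 2 = dotp x x.
Proof. by rewrite sqr_sqrtr// dotp_ge0. Qed.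

Lemma enorm_ge0 x : 0 <= enorm x.
Proof. exact: sqrtr_ge0. Qed.

Lemma enorm_eq0 x : (enorm x == 0) = (x == 0).
Proof. by rewrite -dotp_eq0 -enorm_sqr expf_eq0. Qed.

Lemma clvec_mulK x a : clvec x * (clvec x * a) = - (dotp x x *: a).
Proof. by rewrite mulrA clvec_sqr enorm_sqr mulNr -scalerAl mul1r. Qed.

Lemma clgen_clvec (j : 'I_n) x a :
  clgen R j * (clvec x * a) = - (clvec x * (clgen R j * a)) - (2 * x 0 j) *: a.
Proof.
have := clvec_anticomm x (stdvec R n j); rewrite clvec_stdvec dotp_stdvec => /eqP.
rewrite addrC eq_sym -subr_eq eq_sym => /eqP e.
rewrite !mulrA e mulrBl mulNr -scalerAl mul1r addrC mulr_natl.
by congr (_ - _); rewrite mulrA.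
Qed.

Lemma sum_clgen x a : \sum_j clgen R j * (x 0 j *: a) = clvec x * a.
Proof.
rewrite /clvec mulr_suml; apply: eq_bigr => j _.
by rewrite -scalerAr scalerAl.
Qed.

Lemma sum_clgen_clvec x (F : 'I_n -> C) :
  \sum_j clgen R j * (clvec x * F j) =
  - (clvec x * \sum_j clgen R j * F j) - 2 *: \sum_j x 0 j *: F j.
Proof.
under eq_bigr do rewrite clgen_clvec.
rewrite sumrB sumrN mulr_sumr scaler_sumr; congr (_ - _).
by apply: eq_bigr => j _; rewrite scalerA.
Qed.

Lemma sum_clgen_sqr a : \sum_j clgen R j * (clgen R j * a) = - (n%:R *: a).
Proof.
under eq_bigr do rewrite mulrA clgen_sqr mulN1r.
by rewrite sumr_const card_ord mulNrn scaler_nat.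
Qed.

Lemma is_derive_clvec x v : is_derive x v (@clvec R n) (clvec v).
Proof.
apply: is_derive_bigsum => j _.
have := is_derive_scale (is_derive_coord x v j) (is_derive_cst (clgen R j) x v).
by congr is_derive; rewrite scaler0 addr0.
Qed.

Lemma is_derive_dotp_sqr x v : is_derive x v (fun y : V => dotp y y) (2 * dotp x v).
Proof.
have := @is_derive_bigsum R V R _ (index_enum 'I_n) xpredT
   (fun i y => y 0 i *: y 0 i) (fun i => v 0 i *: x 0 i + x 0 i *: v 0 i) x v.
have h i : true -> is_derive x v (fun y => y 0 i *: y 0 i) (v 0 i *: x 0 i + x 0 i *: v 0 i).
  by move=> _; apply: is_derive_scale; exact: is_derive_coord.
move=> /(_ h); congr is_derive; rewrite /dotp mulr_sumr; apply: eq_bigr => i _.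
by rewrite /GRing.scale/=; ring.
Qed.

Lemma is_derive_dotpl x v u : is_derive x v (fun y : V => dotp y u) (dotp v u).
Proof.
apply: is_derive_bigsum => i _.
have := is_derive_scale (is_derive_coord x v i) (is_derive_cst (u 0 i : R) x v).
by congr is_derive; rewrite scaler0 addr0.
Qed.

(** Restricting to a line reduces directional derivatives to the one-variable calculus of the
    library. *)
Lemma is_derive_line (V' W : normedModType R) (f : V' -> W) (x v : V') df :
  is_derive x v f df <-> is_derive (0 : R) (1 : R) (fun h : R => f (h *: v + x)) df.
Proof.
have e : (fun h : R => h^-1 *: ((f \o shift x) (h *: v) - f x)) =
   (fun h : R => h^-1 *: (((fun h : R => f (h *: v + x)) \o shift (0 : R)) (h *: (1 : R))
        - f (0 *: v + x))).
  by apply/funext => h /=; rewrite addr0 scale0r add0r [_ *: 1]mulr1.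
by split=> -[d1 d2]; apply: DeriveDef;
  rewrite /derivable /derive ?e -?e in d1 d2 *.
Qed.

Lemma is_derive_comp1 (V' : normedModType R) (g : R -> R) (f : V' -> R) (x v : V') df dg :
  is_derive x v f df -> is_derive (f x) 1 g dg ->
  is_derive x v (fun z => g (f z)) (dg * df).
Proof.
move=> /is_derive_line fd gd; apply/is_derive_line.
have gd' : is_derive (f (0 *: v + x)) 1 g dg by rewrite scale0r add0r.
by have := is_derive1_comp gd' fd; congr is_derive.
Qed.

Lemma is_derive_enorm x v : x != 0 -> is_derive x v (@enorm R n) ((enorm x)^-1 * dotp x v).
Proof.
move=> x0; have d0 : 0 < dotp x x by rewrite lt_def dotp_ge0 dotp_eq0 x0.
have := is_derive_comp1 (is_derive_dotp_sqr x v) (is_derive1_sqrt d0).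
congr is_derive; rewrite -/(enorm x).
have e0 : enorm x != 0 by rewrite enorm_eq0.
by field.
Qed.

Lemma is_derive_enormXV m x v : x != 0 ->
  is_derive x v (fun y => (enorm y ^+ m)^-1) (- m%:R * dotp x v * (enorm x ^+ m.+2)^-1).
Proof.
move=> x0; have e0 : enorm x != 0 by rewrite enorm_eq0.
have em : enorm x ^+ m != 0 by rewrite expf_neq0.
have d1 : is_derive x v (fun y => enorm y ^+ m)
    (m%:R * enorm x ^+ m.-1 * ((enorm x)^-1 * dotp x v)).
  have := @is_deriveX R V _ m x v _ (is_derive_enorm v x0).
  by congr is_derive; apply/funext => y; rewrite fctE.
have d2 : is_derive (enorm x ^+ m) 1 (fun t : R => t^-1) (- (enorm x ^+ m) ^- 2).
  have := @is_deriveV R id (enorm x ^+ m) 1 1 em (is_derive_id _ _).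
  by congr is_derive; rewrite [_ *: _]mulr1.
have := is_derive_comp1 d1 d2; congr is_derive.
case: m em {d1 d2} => [|m] em; first by rewrite !(mul0r, mulr0, oppr0).
by rewrite /= !exprS in em *; field; rewrite ?e0 ?expf_neq0.
Qed.

End CliffordVectors.

(** * Monogenic polynomials and a limit-stable condition on u M_(k-1) *)

Section MonogenicFunctions.
Variables (R : realType) (n : nat).
Local Notation V := 'rV[R]_n.
Local Notation C := (Cl R n).
Implicit Types (x y u v : V) (p q h : V -> C).

(** The chain rule itself is taken as the definition. It is inherited by linear combinations such as
    x . grad f, which need not be presented as a [polyf]. *)
Definition has_partials (p : V -> C) (dp : 'I_n -> V -> C) : Prop :=
  forall (w : V -> V) (dw : 'I_n -> R) x v,
    (forall i, is_derive x v (fun y => w y 0 i) (dw i)) ->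
    is_derive x v (fun y => p (w y)) (\sum_j dw j *: dp j (w x)).

Lemma has_partials_stdvec p dp : has_partials p dp ->
  forall u (j : 'I_n), is_derive u (stdvec R n j) p (dp j u).
Proof.
move=> pd u j; have := pd id _ u _ (is_derive_coord u (stdvec R n j)).
congr is_derive; rewrite (bigD1 j)//= mxE eqxx scale1r big1 ?addr0// => i ij.
by rewrite mxE -val_eqE in ij *; rewrite (negPf ij) scale0r.
Qed.

Lemma dirac_is_derive p (dp : 'I_n -> C) u :
    (forall j : 'I_n, is_derive u (stdvec R n j) p (dp j)) ->
  dirac p u = \sum_j clgen R j * dp j.
Proof.
by move=> pd; apply: eq_bigr => j _; congr (_ * _); have := pd j => -[_ ->].
Qed.

Lemma hpoly_partials k p : hpoly k p -> exists dp, has_partials p dp.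
Proof.
move=> /hpolyP[c ->]; eexists => w dw x v wd.
exact: (is_derive_polyf _ _ _ wd).
Qed.

Lemma hpoly_derive k p u (j : 'I_n) : hpoly k p ->
  is_derive u (stdvec R n j) p ('D_(stdvec R n j) p u).
Proof.
move=> /hpoly_partials[dp /has_partials_stdvec/(_ u j) pj].
by have := pj => -[_ ->].
Qed.

(* Equality of mixed partials makes the partial derivatives of a monogenic *)
(* polynomial monogenic again.                                             *)
Lemma monogenic_partials k p : monogenic_poly k p ->
  exists (dp : 'I_n -> V -> C) (ddp : 'I_n -> 'I_n -> V -> C),
  [/\ has_partials p dp, forall u, \sum_j clgen R j * dp j u = 0,
      forall m, has_partials (dp m) (ddp m) &
      forall m u, \sum_j clgen R j * ddp m j u = 0].
Proof.
move=> [/hpolyP[c pE] p0]; move: pE p0.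
set P := (fun _ => _); set b := (fun _ _ => _) => pE p0.
pose dp := dpolyf P b c.
pose ddp m := dpolyf P (fun i => bdec m (b i)) (fun i => (b i m)%:R *: c i).
have chain I0 P0 b0 c0 : has_partials (@polyf R n I0 P0 b0 c0) (dpolyf P0 b0 c0).
  by move=> w dw x v wd; exact: is_derive_polyf.
have dpE u : \sum_j clgen R j * dp j u = 0.
  rewrite -[RHS](p0 u) pE; apply/esym/dirac_is_derive => j; exact: derive_polyf.
exists dp, ddp; split => //.
- by rewrite pE; exact: chain.
- by move=> m; rewrite /dp dpolyfE; exact: chain.
move=> m u.
under eq_bigr do rewrite /ddp dpolyfC.
have h : is_derive u (stdvec R n m) (fun y => \sum_j clgen R j * dp j y)
    (\sum_j clgen R j *
       dpolyf P (fun i => bdec j (b i)) (fun i => (b i j)%:R *: c i) m u).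
  apply: is_derive_bigsum => j _.
  have d1 : is_derive u (stdvec R n m) (dp j)
      (dpolyf P (fun i => bdec j (b i)) (fun i => (b i j)%:R *: c i) m u).
    by rewrite /dp dpolyfE; exact: derive_polyf.
  have := cl_is_deriveM (is_derive_cst (clgen R j) u (stdvec R n m)) d1.
  by congr is_derive; rewrite mul0r add0r.
have h0 : (fun y => \sum_j clgen R j * dp j y) = cst 0 by apply/funext => y; rewrite dpE.
move: h; rewrite h0 => -[_ <-]; exact: derive_cst.
Qed.

Lemma diracD p q u : (forall j : 'I_n, derivable p u (stdvec R n j)) ->
    (forall j : 'I_n, derivable q u (stdvec R n j)) ->
  dirac (fun w => p w + q w) u = dirac p u + dirac q u.
Proof.
move=> dp dq; rewrite /dirac -big_split; apply: eq_bigr => j _ /=.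
by rewrite -mulrDr -deriveD.
Qed.

Lemma diracZ t p u : (forall j : 'I_n, derivable p u (stdvec R n j)) ->
  dirac (fun w => t *: p w) u = t *: dirac p u.
Proof.
move=> dp; rewrite /dirac scaler_sumr; apply: eq_bigr => j _ /=.
by rewrite scalerAr -deriveZ.
Qed.

Lemma hpoly_derivable k p u (j : 'I_n) : hpoly k p -> derivable p u (stdvec R n j).
Proof. by move=> /(hpoly_derive u j)[]. Qed.

Lemma monogenic_polyD k p q : monogenic_poly k p -> monogenic_poly k q ->
  monogenic_poly k (fun u => p u + q u).
Proof.
move=> [hp p0] [hq q0]; split=> [|u]; first exact: hpolyD.
rewrite diracD ?p0 ?q0 ?addr0// => j; [exact: hpoly_derivable hp|exact: hpoly_derivable hq].
Qed.

Lemma monogenic_polyZ k t p : monogenic_poly k p -> monogenic_poly k (fun u => t *: p u).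
Proof.
move=> [hp p0]; split=> [|u]; first exact: hpolyZ.
by rewrite diracZ ?p0 ?scaler0// => j; exact: hpoly_derivable hp.
Qed.

Lemma monogenic_polyMr k a p : monogenic_poly k p -> monogenic_poly k (fun u => p u * a).
Proof.
move=> [hp p0]; split=> [|u]; first exact: hpoly_mulr.
rewrite (@dirac_is_derive _ (fun j => 'D_(stdvec R n j) p u * a) _ _).
  under eq_bigr do rewrite mulrA; rewrite -mulr_suml -/(dirac p u) p0.
  by rewrite mul0r.
move=> j; have := cl_is_deriveM (hpoly_derive u j hp) (is_derive_cst a u (stdvec R n j)).
by congr is_derive; rewrite mulr0 addr0.
Qed.

Lemma monogenic_poly0 k : monogenic_poly k (fun _ : V => 0 : C).
Proof.
split=> [|u]; first exact: hpoly0.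
by rewrite /dirac big1// => j _; rewrite derive_cst mulr0.
Qed.

Lemma monogenic_lim k (T : Type) (F : set_system T) (FF : ProperFilter F)
    (p : T -> V -> C) q :
    (\forall t \near F, monogenic_poly k (p t)) ->
    (forall u, (fun t => p t u) @ F --> q u) ->
  monogenic_poly k q.
Proof.
move=> mp pq.
have hp : \forall t \near F, hpoly k (p t) by apply: filterS mp => t [].
split=> [|u]; first exact: hpoly_lim hp pq.
apply: (cvg_unique (@norm_hausdorff R C) (@dirac_lim R n k T F FF p q hp pq u)).
have : (fun=> 0) @ F --> (0 : C) by exact: cvg_cst.
by apply: cvg_trans; apply: near_eq_cvg; apply: filterS mp => t [_ ->].
Qed.

(** Difference quotients in the parameter x lie in M_k, which is closed under pointwise limits. *)
Lemma monogenic_derive k (G : V -> V -> C) x v :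
    (\forall t \near (0 : R), monogenic_poly k (G (t *: v + x))) ->
    (forall u, derivable (fun y => G y u) x v) ->
  monogenic_poly k (fun u => 'D_v (fun y => G y u) x).
Proof.
move=> mG dG.
apply: (@monogenic_lim k R _ (Proper_dnbhs_numFieldType (0 : R))
  (fun t u => t^-1 *: (G (t *: v + x) u - G x u))); last by move=> u; exact: dG.
  have mx : monogenic_poly k (G x).
    by have := nbhs_singleton mG; rewrite scale0r add0r.
  apply: nbhs_dnbhs; apply: filterS mG => h mh.
  have := monogenic_polyZ h^-1 (monogenic_polyD mh (monogenic_polyZ (-1) mx)).
  by congr monogenic_poly; apply/funext => u; rewrite scaleN1r.

Qed.

(* Satisfied by h = u q with q in M_(k-1), and, unlike that factorization,     *)
(* visibly closed under pointwise limits.                                      *)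
Definition dirac_eigen k h : Prop :=
  hpoly k h /\ forall u, dirac (fun w => clvec w * h w) u = - (2 *: h u).

(** Multiplication by u raises the degree by one, so [dirac_lim] is applied in degree [k.+1]. *)
Lemma dirac_eigen_lim k (T : Type) (F : set_system T) (FF : ProperFilter F)
    (p : T -> V -> C) q :
    (\forall t \near F, dirac_eigen k (p t)) ->
    (forall u, (fun t => p t u) @ F --> q u) ->
  dirac_eigen k q.
Proof.
move=> mp pq.
have hp : \forall t \near F, hpoly k (p t) by apply: filterS mp => t [].
split=> [|u]; first exact: hpoly_lim hp pq.
have hup : \forall t \near F, hpoly k.+1 (fun w => clvec w * p t w).
  by apply: filterS hp => t; exact: hpoly_clvec.
have puq u' : (fun t => clvec u' * p t u') @ F --> clvec u' * q u'.
  by apply: cl_cvgM; [exact: cvg_cst|exact: pq].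
apply: (cvg_unique (@norm_hausdorff R C) (@dirac_lim R n k.+1 T F FF _ _ hup puq u)).
have : (fun t => - (2 *: p t u)) @ F --> - (2 *: q u).
  by apply: cvgN; apply: cvgZr; exact: pq.
by apply: cvg_trans; apply: near_eq_cvg; apply: filterS mp => t [_ ->].
Qed.

Lemma dirac_eigenD k p q : dirac_eigen k p -> dirac_eigen k q ->
  dirac_eigen k (fun u => p u + q u).
Proof.
move=> [hp p0] [hq q0]; split=> [|u]; first exact: hpolyD.
under eq_fun do rewrite mulrDr.
have hup := hpoly_clvec hp; have huq := hpoly_clvec hq.
rewrite diracD ?p0 ?q0 ?scalerDr ?opprD// => j.
  exact: hpoly_derivable hup.
exact: hpoly_derivable huq.
Qed.

Lemma dirac_eigen0 k : dirac_eigen k (fun _ : V => 0 : C).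
Proof.
split=> [|u]; first exact: hpoly0.
under eq_fun do rewrite mulr0.
by have [_ ->] := monogenic_poly0 k; rewrite scaler0 oppr0.
Qed.

End MonogenicFunctions.

(** * Fischer decomposition, the reflected kernel, and the equation for a single term *)

Section RaritaSchwinger.
Variables (R : realType) (n : nat).
Local Notation V := 'rV[R]_n.
Local Notation C := (Cl R n).
Implicit Types (x y u v : V) (p q h : V -> C).

(** Euler's identity, checked on monomials. *)
Lemma hpoly_euler k q u : hpoly k q ->
  \sum_(j < n) u 0 j *: 'D_(stdvec R n j) q u = k%:R *: q u.
Proof.
move=> /hpolyP[c ->].
pose P (a : {ffun 'I_n -> 'I_k.+1}) := mdeg a == k.
pose b (a : {ffun 'I_n -> 'I_k.+1}) (i : 'I_n) : nat := a i.
transitivity (\sum_(j < n) u 0 j *: dpolyf P b c j u).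
  by apply: eq_bigr => j _; have [_ ->] := derive_polyf P b c j u.
under eq_bigr do rewrite scaler_sumr.
rewrite exchange_big /= scaler_sumr; apply: eq_bigr => a /eqP ak.
under eq_bigr do rewrite scalerA.
rewrite -scaler_suml scalerA; congr (_ *: _).
have kE : k%:R = \sum_j (b a j)%:R :> R.
  by rewrite -natr_sum; congr (_%:R); exact: esym.
rewrite kE mulr_suml; apply: eq_bigr => j _.
rewrite /dgmon mulrCA; have [aj|aj] := posnP (b a j).
  by rewrite aj !mul0r.
congr (_ * _); rewrite /gmon (bigD1 j)//= [RHS](bigD1 j)//= mulrA /bdec eqxx -exprS prednK//.
by congr (_ * _); apply: eq_bigr => i /negPf ->.
Qed.

(** The derivative of u contributes the sum of e_j e_j = -1; moving e_j past u by e_j u = - u e_j -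
    2 u_j yields the other two terms. *)
Lemma dirac_clvecM q u : (forall j : 'I_n, derivable q u (stdvec R n j)) ->
  dirac (fun w => clvec w * q w) u =
  - (n%:R *: q u) - clvec u * dirac q u - 2 *: \sum_(j < n) u 0 j *: 'D_(stdvec R n j) q u.
Proof.
move=> dq.
rewrite (@dirac_is_derive _ _ _ (fun j => clgen R j * q u + clvec u * 'D_(stdvec R n j) q u) _ _).
  under eq_bigr do rewrite mulrDr.
  by rewrite big_split/= sum_clgen_sqr sum_clgen_clvec addrA.
move=> j; rewrite -clvec_stdvec.
exact: cl_is_deriveM (is_derive_clvec u _) (derivableP (dq j)).
Qed.

(** Directness of the Fischer sum: for q in M_d, D(u q) = -(n + 2d) q, and the scalar is nonzero. *)
Lemma monogenic_umonogenic_eq0 d p : (0 < n)%N ->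
  monogenic_poly d.+1 p -> umonogenic_poly d p -> p = (fun=> 0).
Proof.
move=> n0 [_ p0] [q [hq q0] pE]; apply/funext => u.
have := p0 u; have -> : p = (fun u => clvec u * q u) by apply/funext.
rewrite dirac_clvecM => [|j]; last exact: hpoly_derivable hq.
rewrite q0 mulr0 subr0 (hpoly_euler _ hq) scalerA -opprD -scalerDl => /eqP.
rewrite oppr_eq0 scaler_eq0 => /orP[|/eqP ->]; last by rewrite mulr0.
by rewrite paddr_eq0// ?mulr_ge0// pnatr_eq0 gtn_eqF.
Qed.

(** [h] with remainder 0 is an admissible choice, and by directness [xget] can return nothing
    else. *)
Lemma fischerP_monogenic d h : (0 < n)%N -> monogenic_poly d.+1 h -> fischerP d.+1 h = h.
Proof.
move=> n0 mh; rewrite /fischerP /=.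
have hP : [set p | monogenic_poly d.+1 p /\ umonogenic_poly d (fun u => h u - p u)] h.
  split=> //; exists (fun=> 0); first exact: monogenic_poly0.
  by move=> u; rewrite subrr mulr0.
have [mp up] := @xgetPex _ (fun=> 0) _ (ex_intro _ h hP).
move: mp up; set p := xget _ _ => mp up.
have m : monogenic_poly d.+1 (fun u => h u - p u).
  have := monogenic_polyD mh (monogenic_polyZ (-1) mp).
  by congr monogenic_poly; apply/funext => u; rewrite scaleN1r.
apply/funext => u; apply/eqP; rewrite eq_sym -subr_eq0; apply/eqP.
by have /(congr1 (@^~ u)) := monogenic_umonogenic_eq0 n0 m up.
Qed.

(** Since u u = -|u|^2, the function u p is -|u|^2 q; the Dirac operator kills q and sends |u|^2 to
    2 u. *)
Lemma dirac_eigen_clvecM d p q : hpoly d p ->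
    (forall u, p u = clvec u * q u) ->
    (forall u (j : 'I_n), derivable q u (stdvec R n j)) -> (forall u, dirac q u = 0) ->
  dirac_eigen d p.
Proof.
move=> hp pE dq q0; split=> // u.
have -> : (fun w => clvec w * p w) = (fun w => - (dotp w w *: q w)).
  by apply/funext => w; rewrite pE clvec_mulK.
rewrite (@dirac_is_derive _ _ _ (fun j =>
   - ((2 * u 0 j) *: q u + dotp u u *: 'D_(stdvec R n j) q u)) _ _).
  under eq_bigr do rewrite mulrN mulrDr -!scalerAr.
  rewrite sumrN big_split/= -scaler_sumr -/(dirac q u) q0 scaler0 addr0 pE.
  congr (- _); rewrite -sum_clgen scaler_sumr; apply: eq_bigr => j _.
  by rewrite -scalerAr scalerA.
move=> j; apply: is_deriveN.
have := is_derive_scale (is_derive_dotp_sqr u (stdvec R n j)) (derivableP (dq u j)).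
by rewrite dotp_stdvec.
Qed.

(* With h = D_x G, D_x (u G) = - u h - 2 <u, grad_x> G, and the Dirac operator *)
(* in u sends the two terms to 2 h and - 2 h.                                  *)
Lemma monogenic_dirac_clvecM d (G : V -> V -> C) x :
    (\forall y \near x, monogenic_poly d (G y)) ->
    (forall u (j : 'I_n), derivable (fun y => G y u) x (stdvec R n j)) ->
    dirac_eigen d (fun u => dirac (fun y => G y u) x) ->
  monogenic_poly d.+1 (fun u => dirac (fun y => clvec u * G y u) x).
Proof.
move=> mG dG [hh h2].
pose g (j : 'I_n) u := 'D_(stdvec R n j) (fun y => G y u) x.
have mg j : monogenic_poly d (g j).
  apply: monogenic_derive => //.
  by have /(_ _ mG) := @cvg_line R V x (stdvec R n j).
have DE : (fun u => dirac (fun y => clvec u * G y u) x) =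
    (fun u => - (clvec u * dirac (fun y => G y u) x) - 2 *: \sum_j u 0 j *: g j u).
  apply/funext => u; rewrite -sum_clgen_clvec; apply: dirac_is_derive => j.
  have := cl_is_deriveM (is_derive_cst (clvec u) x (stdvec R n j)) (derivableP (dG u j)).
  by congr is_derive; rewrite mul0r add0r.
have hug : hpoly d.+1 (fun u => \sum_j u 0 j *: g j u).
  by apply: hpoly_sum => j _; apply: hpoly_coord; case: (mg j).
have huh := hpoly_clvec hh.
split.
  rewrite DE; apply: hpolyD; [have := hpolyZ (-1) huh|have := hpolyZ (-2) hug];
    by congr hpoly; apply/funext => u; rewrite ?scaleN1r ?scaleNr.
move=> u; rewrite DE.
have -> : (fun u => - (clvec u * dirac (fun y => G y u) x) - 2 *: \sum_j u 0 j *: g j u) =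
  (fun u => (-1) *: (clvec u * dirac (fun y => G y u) x) +
   (-2) *: \sum_j u 0 j *: g j u).
  by apply/funext => w; rewrite scaleN1r scaleNr.
rewrite diracD; [|move=> j; apply: (hpoly_derivable (k := d.+1)); exact: (hpolyZ (-1) huh)
                 |move=> j; apply: (hpoly_derivable (k := d.+1)); exact: (hpolyZ (-2) hug)].
rewrite !diracZ; [|move=> j; apply: (hpoly_derivable (k := d.+1)); exact: hug
                 |move=> j; apply: (hpoly_derivable (k := d.+1)); exact: huh].
rewrite h2 scaleN1r opprK scaleNr -scalerBr; apply/eqP.
rewrite scaler_eq0 subr_eq0; apply/orP; right; apply/eqP/esym.
rewrite (@dirac_is_derive _ _ _ (fun i => g i u + \sum_j u 0 j *: 'D_(stdvec R n i) (g j) u) _ _).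
  under eq_bigr do rewrite mulrDr mulr_sumr.
  rewrite big_split/= [X in _ + X]exchange_big/= [X in _ + X]big1 ?addr0// => j _.
  under eq_bigr do rewrite -scalerAr.
  by rewrite -scaler_sumr -/(dirac (g j) u); have [_ ->] := mg j; rewrite scaler0.
move=> i.
have : is_derive u (stdvec R n i) (fun w => \sum_j w 0 j *: g j w)
   (\sum_j (stdvec R n i 0 j *: g j u + u 0 j *: 'D_(stdvec R n i) (g j) u)).
  apply: is_derive_bigsum => j _; apply: is_derive_scale; first exact: is_derive_coord.
  by apply: (hpoly_derive (k := d)); case: (mg j).
congr is_derive; rewrite big_split/=; congr (_ + _).
rewrite (bigD1 i)//= mxE eqxx scale1r big1 ?addr0// => j ij.
by rewrite mxE -val_eqE in ij *; rewrite (negPf ij) scale0r.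
Qed.

(* x u x / |x|^2 for x != 0 *)
Definition refl x u : V := u - (2 * dotp x u / dotp x x) *: x.

Lemma sum_scale_refl x v (F : 'I_n -> C) :
  \sum_i refl x v 0 i *: F i =
  \sum_i v 0 i *: F i - (2 * dotp x v / dotp x x) *: \sum_i x 0 i *: F i.
Proof.
rewrite scaler_sumr -sumrB; apply: eq_bigr => i _.
by rewrite !mxE scalerBl scalerA.
Qed.

Lemma sum_stdvec (j : 'I_n) (F : 'I_n -> C) : \sum_i stdvec R n j 0 i *: F i = F j.
Proof.
rewrite (bigD1 j)//= mxE eqxx scale1r big1 ?addr0// => i ij.
by rewrite mxE -val_eqE in ij *; rewrite (negPf ij) scale0r.
Qed.

Lemma is_derive_refl x u v i : is_derive u v (fun w => refl x w 0 i) (refl x v 0 i).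
Proof.
have -> : (fun w => refl x w 0 i) =
    (fun w => w 0 i - (2 / dotp x x * x 0 i) *: dotp w x).
  by apply/funext => w; rewrite !mxE [dotp w x]dotpC /GRing.scale/=; ring.
have := is_deriveB (is_derive_coord u v i)
  (is_deriveZ (2 / dotp x x * x 0 i) (is_derive_dotpl u v x)).
congr is_derive; rewrite !mxE [dotp v x]dotpC /GRing.scale/=; ring.
Qed.

(** Conformal invariance. With S = x . grad f at the reflected point, moving e_j past x leaves -2 S
    once D f = 0 is used; the derivative of the reflection contributes -(2/|x|^2) x x S = 2 S. *)
Lemma monogenic_refl p (dp : 'I_n -> V -> C) x u : x != 0 -> has_partials p dp ->
    (forall w, \sum_j clgen R j * dp j w = 0) ->
  (forall j : 'I_n, derivable (fun w => clvec x * p (refl x w)) u (stdvec R n j)) /\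
  dirac (fun w => clvec x * p (refl x w)) u = 0.
Proof.
move=> x0 pdp dp0.
have d (j : 'I_n) : is_derive u (stdvec R n j) (fun w => clvec x * p (refl x w))
    (clvec x * (dp j (refl x u) -
       (2 * x 0 j / dotp x x) *: \sum_i x 0 i *: dp i (refl x u))).
  have := cl_is_deriveM (is_derive_cst (clvec x) u (stdvec R n j))
    (pdp _ _ _ _ (is_derive_refl x u (stdvec R n j))).
  by congr is_derive; rewrite mul0r add0r sum_scale_refl sum_stdvec dotp_stdvec.
split=> [j|]; first by case: (d j).
rewrite (dirac_is_derive d).
under eq_bigr do rewrite mulrBr mulrBr -!scalerAr.
rewrite sumrB sum_clgen_clvec dp0 mulr0 oppr0 sub0r.
set S := \sum_j x 0 j *: _.
have -> : \sum_(j < n) (2 * x 0 j / dotp x x) *: (clgen R j * (clvec x * S)) = - (2 *: S).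
  transitivity ((2 / dotp x x) *: \sum_j clgen R j * (x 0 j *: (clvec x * S))).
    rewrite scaler_sumr; apply: eq_bigr => j _.
    by rewrite -scalerAr scalerA mulrAC.
  rewrite sum_clgen clvec_mulK scalerN scalerA divfK// dotp_eq0//.
by rewrite opprK addNr.
Qed.

(** The function G(x, u) of the outline, for a general polynomial [p] in the role of f. *)
Definition refl_kernel p x u : C := (enorm x ^+ n)^-1 *: (clvec x * p (refl x u)).

Lemma monogenic_refl_kernel d p x : monogenic_poly d p -> x != 0 ->
  monogenic_poly d (refl_kernel p x).
Proof.
move=> mp x0; apply: monogenic_polyZ; split=> [|u].
  apply: hpoly_mull; case: mp => hp _.
  apply: (hpoly_comp (A := \matrix_(i, j) ((i == j)%:R - 2 * x 0 j / dotp x x * x 0 i))) hp.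
  move=> u i; under eq_bigr do rewrite !mxE mulrBl.
  rewrite !mxE sumrB; congr (_ - _).
    by rewrite (bigD1 i)//= eqxx mul1r big1 ?addr0// => j ij; rewrite eq_sym (negPf ij) mul0r.
  rewrite /dotp mulr_sumr !mulr_suml; apply: eq_bigr => j _.
  ring.
have [dp [ddp [pdp p0 _ _]]] := monogenic_partials mp.
by have [] := monogenic_refl u x0 pdp p0.
Qed.

Lemma is_derive_refl_base x v u i : x != 0 ->
  is_derive x v (fun y => refl y u 0 i)
    (- (2 / dotp x x) * (dotp v u * x 0 i + dotp x u * v 0 i)
     + 4 * dotp x u * dotp x v / dotp x x ^+ 2 * x 0 i).
Proof.
move=> x0; have d0 : dotp x x != 0 by rewrite dotp_eq0.
have dV : is_derive x v (fun y => (dotp y y)^-1) (- (dotp x x) ^- 2 * (2 * dotp x v)).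
  apply: is_derive_comp1 (is_derive_dotp_sqr x v) _.
  have := @is_deriveV R id (dotp x x) 1 1 d0 (is_derive_id _ _).
  by congr is_derive; rewrite [_ *: _]mulr1.
have -> : (fun y => refl y u 0 i) =
    (fun y => u 0 i - (2 *: (dotp y u *: ((dotp y y)^-1 *: y 0 i)))).
  by apply/funext => y; rewrite !mxE /GRing.scale/=; ring.
have := is_deriveB (is_derive_cst (u 0 i) x v) (is_deriveZ 2
  (is_derive_scale (is_derive_dotpl x v u) (is_derive_scale dV (is_derive_coord x v i)))).
congr is_derive; rewrite /GRing.scale/=; field.
by rewrite d0.
Qed.

Lemma is_derive_refl_kernel p (dp : 'I_n -> V -> C) x v u : has_partials p dp -> x != 0 ->
  is_derive x v (fun y => refl_kernel p y u)
   ((- n%:R * dotp x v * (enorm x ^+ n.+2)^-1) *: (clvec x * p (refl x u)) +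
    (enorm x ^+ n)^-1 *: (clvec v * p (refl x u) + clvec x * \sum_i
     (- (2 / dotp x x) * (dotp v u * x 0 i + dotp x u * v 0 i)
     + 4 * dotp x u * dotp x v / dotp x x ^+ 2 * x 0 i) *: dp i (refl x u))).
Proof.
move=> pdp x0; apply: is_derive_scale; first exact: is_derive_enormXV.
apply: cl_is_deriveM; first exact: is_derive_clvec.
by apply: (pdp (fun y => refl y u)) => i; exact: is_derive_refl_base.
Qed.

(** The terms containing f itself cancel because x/|x|^n is monogenic. Of the terms with derivatives
    of f, only the one coming from the derivative of <x, u> with respect to x survives, and it
    carries the left factor u. *)
Lemma dirac_refl_kernel p (dp : 'I_n -> V -> C) x u : has_partials p dp ->
    (forall w, \sum_j clgen R j * dp j w = 0) -> x != 0 ->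
  dirac (fun y => refl_kernel p y u) x = clvec u *
    ((-2 * (enorm x ^+ n.+2)^-1) *: (clvec x * \sum_i x 0 i *: dp i (refl x u))).
Proof.
move=> pdp dp0 x0; have d0 : dotp x x != 0 by rewrite dotp_eq0.
have e0 : enorm x != 0 by rewrite enorm_eq0.
rewrite (dirac_is_derive (fun j => is_derive_refl_kernel (stdvec R n j) u pdp x0)).
set f := p (refl x u); pose F i := dp i (refl x u); rewrite -/(F _).
set S := \sum_i x 0 i *: F i.
set s := dotp x u; set d := dotp x x.
set r := (enorm x ^+ n)^-1; set r2 := (enorm x ^+ n.+2)^-1.
have rd : r2 * d = r.
  rewrite /r2 /r /d -enorm_sqr -addn2 exprD invfM divfK// expf_neq0//.
pose A := - (2 / d) *: S; pose B := (4 * s / d ^+ 2) *: S; pose c := - (2 / d * s).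
transitivity (\sum_j (clgen R j * (x 0 j *: ((- n%:R * r2) *: (clvec x * f))) +
   r *: (clgen R j * (clgen R j * f)) +
   r *: (clgen R j * (u 0 j *: (clvec x * A))
   + clgen R j * (x 0 j *: (clvec x * B))
   + c *: (clgen R j * (clvec x * F j))))).
  apply: eq_bigr => j _.
  rewrite dotp_stdvec clvec_stdvec [dotp (stdvec _ _ _) u]dotpC dotp_stdvec.
  have -> : \sum_i (- (2 / d) * (u 0 j * x 0 i + s * stdvec R n j 0 i) +
       4 * s * x 0 j / d ^+ 2 * x 0 i) *: dp i (refl x u) =
     u 0 j *: A + x 0 j *: B + c *: F j.
    rewrite -[F j]sum_stdvec /A /B /S !scaler_sumr -!big_split/=.
    apply: eq_bigr => i _; rewrite !scalerA -!scalerDl; congr (_ *: _).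
    rewrite /c /GRing.scale/=; ring.
  rewrite !mulrDr -!scalerAr !mulrDr -!scalerAr !scalerDr !scalerA !addrA.
  by rewrite [- _ * _ * _]mulrAC [x 0 j * _]mulrC.
rewrite !big_split/= -!scaler_sumr !big_split/= -!scaler_sumr !sum_clgen.
rewrite sum_clgen_sqr sum_clgen_clvec dp0 mulr0 oppr0 sub0r -/S.
rewrite -scalerAr !clvec_mulK -/d.
have -> : (- n%:R * r2) *: - (d *: f) + r *: - (n%:R *: f) = 0.
  by rewrite !scalerN !scalerA -opprD -scalerDl -rd !mulNr -mulrA mulrC addNr scale0r oppr0.
rewrite add0r /A /B -!scalerAr scalerN !scalerA.
(* The derivative of 1/|x|^2 and the anticommutator of e_j with x give opposite multiples of S. *)
have -> : c * 2 = - (d * (4 * s / d ^+ 2)) by rewrite /c; field.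
rewrite [(- (d * _)) *: _]scaleNr opprK subrK scalerA -rd; congr (_ *: _); field; exact: d0.
Qed.

Lemma near_line_neq0 x v : x != 0 -> \forall t \near (0 : R), t *: v + x != 0.
Proof.
by move=> x0; exact: cvgr_neq0 (@cvg_line R V x v) x0.
Qed.

Lemma derivable_refl_kernel d p x v u : monogenic_poly d p -> x != 0 ->
  derivable (fun y => refl_kernel p y u) x v.
Proof.
move=> /monogenic_partials[dp [ddp [pdp _ _ _]]] x0.
by have [] := is_derive_refl_kernel v u pdp x0.
Qed.

(** The factor q in D_x G = u q is a multiple of x S(refl x u), where S = x . grad f is monogenic
    because the partials of f are; so [monogenic_refl] applies again, to S. *)
Lemma dirac_eigen_refl_kernel d p x : monogenic_poly d p -> x != 0 ->
  dirac_eigen d (fun u => dirac (fun y => refl_kernel p y u) x).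
Proof.
move=> mp x0; have [dp [ddp [pdp dp0 dpdp ddp0]]] := monogenic_partials mp.
pose S u := \sum_i x 0 i *: dp i u.
have Spart : has_partials S (fun j u => \sum_i x 0 i *: ddp i j u).
  move=> w dw y v wd.
  have : is_derive y v (fun z => S (w z)) (\sum_i x 0 i *: \sum_j dw j *: ddp i j (w y)).
    by apply: is_derive_bigsum => i _; apply: is_deriveZ; exact: dpdp.
  congr is_derive; under eq_bigr do rewrite scaler_sumr.
  rewrite exchange_big/=; apply: eq_bigr => j _; rewrite scaler_sumr.
  by apply: eq_bigr => i _; rewrite !scalerA mulrC.
have S0 w : \sum_j clgen R j * (\sum_i x 0 i *: ddp i j w) = 0.
  under eq_bigr do rewrite mulr_sumr.
  rewrite exchange_big/= big1// => i _; under eq_bigr do rewrite -scalerAr.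
  by rewrite -scaler_sumr ddp0 scaler0.
apply: (dirac_eigen_clvecM (q := fun u =>
  (-2 * (enorm x ^+ n.+2)^-1) *: (clvec x * S (refl x u)))).
- rewrite /dirac; apply: hpoly_sum => j _; apply: hpoly_mull.
  have [] // : monogenic_poly d (fun u => 'D_(stdvec R n j) (fun y => refl_kernel p y u) x).
  apply: monogenic_derive => [|u]; last exact: derivable_refl_kernel mp x0.
  apply: filterS (near_line_neq0 (stdvec R n j) x0) => t.
  exact: monogenic_refl_kernel mp.
- by move=> u; rewrite (dirac_refl_kernel _ pdp).
- move=> u j; apply: derivableZ.
  by have [] := monogenic_refl u x0 Spart S0.
- move=> u; have [h1 h2] := monogenic_refl u x0 Spart S0.
  by rewrite diracZ// h2 scaler0.
Qed.

End RaritaSchwinger.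

(** * Bounded Lipschitz functions on an annulus *)

Section BoundedLipschitz.
Variables (R : realType) (n : nat).
Local Notation V := 'rV[R]_n.

(** The radii are such that y + h, divided by |y|, stays inside whenever |h| <= |y|/2. *)
Definition annulus (y : V) : bool := 1 / 2 <= `|y| <= 3 / 2.

(** A class closed under sums and bilinear products, so Lipschitz bounds come from the formula of
    the kernel; a mean value argument would be awkward on a set that is not convex. *)
Definition blip (W : normedModType R) (f : V -> W) : Prop :=
  exists2 K, 0 <= K & forall y z, annulus y -> annulus z ->
    `|f y| <= K /\ `|f y - f z| <= K * `|y - z|.

Lemma blip_cst (W : normedModType R) (a : W) : blip (fun=> a).
Proof.
exists `|a| => // y z _ _; split=> //.
by rewrite subrr normr0 mulr_ge0.
Qed.

Lemma blipD (W : normedModType R) (f g : V -> W) :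
  blip f -> blip g -> blip (fun y => f y + g y).
Proof.
move=> [K K0 fK] [L L0 gL]; exists (K + L) => [|y z yA zA]; first exact: addr_ge0.
have [f1 f2] := fK _ _ yA zA; have [g1 g2] := gL _ _ yA zA; split.
  by rewrite (le_trans (ler_normD _ _))// lerD.
by rewrite opprD addrACA mulrDl (le_trans (ler_normD _ _))// lerD.
Qed.

Lemma blip_bilin (U W X : normedModType R) (B : U -> W -> X) (M : R)
    (f : V -> U) (g : V -> W) :
    (forall a a' b, B (a - a') b = B a b - B a' b) ->
    (forall a b b', B a (b - b') = B a b - B a b') ->
    0 <= M -> (forall a b, `|B a b| <= M * (`|a| * `|b|)) ->
  blip f -> blip g -> blip (fun y => B (f y) (g y)).
Proof.
move=> Bl Br M0 BM [K K0 fK] [L L0 gL].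
exists (M * (2 * (K * L))) => [|y z yA zA]; first by rewrite !mulr_ge0.
have [f1 f2] := fK _ _ yA zA; have [g1 g2] := gL _ _ yA zA.
have [g3 _] := gL _ _ zA yA; split.
  apply: (le_trans (BM _ _)); apply: ler_wpM2l => //.
  apply: (@le_trans _ _ (K * L)); first by apply: ler_pM.
  by rewrite ler_peMl ?mulr_ge0// ler1n.
have -> : B (f y) (g y) - B (f z) (g z) = B (f y) (g y - g z) + B (f y - f z) (g z).
  by rewrite Bl Br addrA subrK.
apply: (le_trans (ler_normD _ _)); apply: (le_trans (lerD (BM _ _) (BM _ _))).
rewrite -mulrDr -!mulrA; apply: ler_wpM2l => //.
apply: (@le_trans _ _ (K * (L * `|y - z|) + K * `|y - z| * L)).
  by apply: lerD; apply: ler_pM.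
by rewrite le_eqVlt; apply/orP; left; apply/eqP; ring.
Qed.

Lemma blipM (f g : V -> R) : blip f -> blip g -> blip (fun y => f y * g y).
Proof.
apply: (@blip_bilin R R R (fun a b => a * b) 1) => //.
- by move=> *; exact: mulrBl.
- by move=> *; exact: mulrBr.
- by move=> a b; rewrite mul1r normrM.
Qed.

Lemma blipZ (W : normedModType R) (f : V -> R) (g : V -> W) :
  blip f -> blip g -> blip (fun y => f y *: g y).
Proof.
apply: (@blip_bilin R W W (fun a b => a *: b) 1) => //.
- by move=> *; exact: scalerBl.
- by move=> *; exact: scalerBr.
- by move=> a b; rewrite mul1r normrZ.
Qed.

Lemma blip_clmul (f g : V -> Cl R n) : blip f -> blip g -> blip (fun y => f y * g y).
Proof.
apply: (@blip_bilin (Cl R n) (Cl R n) (Cl R n) (fun a b => a * b) (clmulK R n)).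
- by move=> *; exact: mulrBl.
- by move=> *; exact: mulrBr.
- exact: clmulK_ge0.
- exact: cl_normrM.
Qed.

Lemma blip_sum (W : normedModType R) (I : Type) (r : seq I) (P : pred I) (f : I -> V -> W) :
  (forall i, P i -> blip (f i)) -> blip (fun y => \sum_(i <- r | P i) f i y).
Proof.
move=> fB; elim: r => [|i r IH].
  by under eq_fun do rewrite big_nil; exact: blip_cst.
under eq_fun do rewrite big_cons; case: (boolP (P i)) => // Pi.
exact: blipD (fB i Pi) IH.
Qed.

Lemma blipX (f : V -> R) m : blip f -> blip (fun y => f y ^+ m).
Proof.
move=> fB; elim: m => [|m IH]; first by under eq_fun do rewrite expr0; exact: blip_cst.
by under eq_fun do rewrite exprS; exact: blipM.
Qed.

Lemma blip_prod (I : Type) (r : seq I) (f : I -> V -> R) :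
  (forall i, blip (f i)) -> blip (fun y => \prod_(i <- r) f i y).
Proof.
move=> fB; elim: r => [|i r IH].
  by under eq_fun do rewrite big_nil; exact: blip_cst.
by under eq_fun do rewrite big_cons; exact: blipM.
Qed.

Lemma normr_coord (y : V) i : `|y 0 i| <= `|y|.
Proof.
rewrite [leRHS]/Num.Def.normr/= mx_normrE.
exact: (le_bigmax _ (fun j => `|y j.1 j.2|) (0, i)).
Qed.

Lemma blip_coord i : blip (fun y : V => y 0 i).
Proof.
exists (3 / 2) => // y z /andP[_ y2] _; split; first exact: le_trans (normr_coord _ _) y2.
have -> : y 0 i - z 0 i = (y - z) 0 i by rewrite !mxE.
by rewrite (le_trans (normr_coord _ _))// ler_peMl//; lra.
Qed.

Lemma normr_le_enorm (y : V) : `|y| <= enorm y.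
Proof.
rewrite [leLHS]/Num.Def.normr/= mx_normrE (bigmax_le _ (enorm_ge0 _))// => -[i j] _ /=.
rewrite (ord1 i) -(ler_pXn2r (n := 2))// ?nnegrE ?enorm_ge0// enorm_sqr real_normK ?num_real//.
rewrite /dotp (bigD1 j)//= -expr2 lerDl; apply: sumr_ge0 => m _.
exact: sqr_ge0.
Qed.

Lemma enorm_annulus y : annulus y -> 1 / 2 <= enorm y.
Proof. by move=> /andP[y1 _]; exact: le_trans y1 (normr_le_enorm y). Qed.

Lemma blip_dotp u : blip (fun y : V => dotp y u).
Proof. by apply: blip_sum => i _; apply: blipM; [exact: blip_coord|exact: blip_cst]. Qed.

Lemma blip_dotp_sqr : blip (fun y : V => dotp y y).
Proof. by apply: blip_sum => i _; apply: blipM; exact: blip_coord. Qed.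

(** The identity 1/a - 1/b = -(a^2 - b^2) / (a b (a + b)) reduces the claim to the polynomial |y|^2,
    with a, b >= 1/2. *)
Lemma blip_enormV : blip (fun y : V => (enorm y)^-1).
Proof.
have [K K0 dK] := blip_dotp_sqr.
exists (4 * K + 2) => [|y z yA zA]; first by rewrite addr_ge0// mulr_ge0.
have [_ d2] := dK _ _ yA zA.
have ey := enorm_annulus yA; have ez := enorm_annulus zA.
have ey0 : 0 < enorm y by lra.
have ez0 : 0 < enorm z by lra.
have eyV : (enorm y)^-1 <= 2 by rewrite invf_ple ?posrE//; lra.
have ezV : (enorm z)^-1 <= 2 by rewrite invf_ple ?posrE//; lra.
split.
  rewrite ger0_norm ?invr_ge0 ?enorm_ge0//; apply: (le_trans eyV).
  by rewrite lerDr mulr_ge0.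
have -> : (enorm y)^-1 - (enorm z)^-1 =
    - (((enorm y)^-1 * (enorm z)^-1) * (enorm y + enorm z)^-1 * (dotp y y - dotp z z)).
  rewrite -!enorm_sqr; field.
  by rewrite (gt_eqF ey0) (gt_eqF ez0) gt_eqF// addr_gt0.
rewrite normrN !normrM !normfV !(@ger0_norm _ (enorm _)) ?enorm_ge0//.
rewrite (@ger0_norm _ (_ + _)) ?addr_ge0 ?enorm_ge0//.
have yzV : (enorm y + enorm z)^-1 <= 1 by rewrite invf_ple ?posrE ?addr_gt0//; lra.
apply: (@le_trans _ _ (2 * 2 * 1 * (K * `|y - z|))).
  by rewrite !ler_pM ?mulr_ge0 ?invr_ge0 ?addr_ge0 ?enorm_ge0.
rewrite mulr1 mulrA ler_wpM2r// -natrM; lra.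
Qed.

End BoundedLipschitz.

(** * Homogeneity, oddness and decay of the kernel *)

Section KernelEstimates.
Variables (R : realType) (n : nat).
Local Notation V := 'rV[R]_n.
Local Notation C := (Cl R n).
Implicit Types (y z h u : V).

Lemma blip_refl_kernel d (p : V -> C) u : hpoly d p -> blip (fun y => refl_kernel p y u).
Proof.
move=> /hpolyP[c ->].
apply: blipZ.
  by under eq_fun do rewrite -exprVn; apply: blipX; exact: blip_enormV.
apply: blip_clmul.
  by apply: blip_sum => i _; apply: blipZ; [exact: blip_coord|exact: blip_cst].
apply: blip_sum => a _; apply: blipZ; last exact: blip_cst.
apply: blip_prod => i; apply: blipX.
have -> : (fun y => refl y u 0 i) = (fun y =>
    u 0 i + (-2 * (dotp y u * ((enorm y)^-1 ^+ 2 * y 0 i)))).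
  by apply/funext => y; rewrite !mxE exprVn enorm_sqr; ring.
apply: blipD; first exact: blip_cst.
apply: blipM; first exact: blip_cst.
apply: blipM; first exact: blip_dotp.
by apply: blipM; [apply: blipX; exact: blip_enormV|exact: blip_coord].
Qed.

Lemma dotpZl (t : R) y z : dotp (t *: y) z = t * dotp y z.
Proof. by rewrite dotpC dotpZr dotpC. Qed.

Lemma enormZ (t : R) y : 0 <= t -> enorm (t *: y) = t * enorm y.
Proof.
by move=> t0; rewrite /enorm dotpZl dotpZr mulrA -expr2 sqrtrM ?sqr_ge0// sqrtr_sqr ger0_norm.
Qed.

Lemma reflZ (t : R) y u : t != 0 -> refl (t *: y) u = refl y u.
Proof.
move=> t0; rewrite /refl !dotpZl dotpZr scalerA; congr (_ - _ *: _).
have [->|y0] := eqVneq y 0.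
  by rewrite /dotp !(big1, mulr0, mul0r)// => i _; rewrite mxE mul0r.
by field; rewrite t0 dotp_eq0 y0.
Qed.

Lemma refl_kernelZ (p : V -> C) (t : R) y u : 0 < t ->
  refl_kernel p (t *: y) u = ((t ^+ n)^-1 * t) *: refl_kernel p y u.
Proof.
move=> t0; rewrite /refl_kernel (enormZ _ (ltW t0)) reflZ ?gt_eqF// clvecZ.
by rewrite exprMn invfM -scalerAl !scalerA mulrAC.
Qed.

Lemma refl_kernelN (p : V -> C) y u : refl_kernel p (- y) u = - refl_kernel p y u.
Proof.
have -> : - y = (-1) *: y by rewrite scaleN1r.
rewrite /refl_kernel reflZ ?oppr_eq0 ?oner_eq0// clvecZ !scaleN1r mulNr scalerN.
by congr (- (_ *: _)); rewrite /enorm -scaleN1r dotpZl dotpZr !mulN1r opprK.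
Qed.

Lemma refl_kernel0 (p : V -> C) u : refl_kernel p 0 u = 0.
Proof.
rewrite /refl_kernel (_ : clvec 0 = 0) ?mul0r ?scaler0//.
by rewrite /clvec big1// => i _; rewrite mxE scale0r.
Qed.

Lemma invX_pred (t : R) m : (0 < m)%N -> t != 0 -> (t ^+ m.-1)^-1 = (t ^+ m)^-1 * t.
Proof. by case: m => //= m _ t0; rewrite exprS invfM mulrAC mulVf ?mul1r. Qed.

(* Both bounds follow by homogeneity from those on the annulus. *)
Lemma refl_kernel_bounds d (p : V -> C) u : (0 < n)%N -> hpoly d p -> exists2 K, 0 <= K &
  (forall y, y != 0 -> `|refl_kernel p y u| <= K * (`|y| ^+ n.-1)^-1) /\
  (forall y h, y != 0 -> `|h| <= `|y| / 2 ->
     `|refl_kernel p (y + h) u - refl_kernel p y u| <= K * `|h| * (`|y| ^+ n)^-1).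
Proof.
move=> n0 /(blip_refl_kernel u)[K K0 pK]; exists K => //.
have hom y : y != 0 -> forall z, refl_kernel p z u =
    (`|y| ^+ n.-1)^-1 *: refl_kernel p (`|y|^-1 *: z) u.
  move=> y0 z; have ny0 : 0 < `|y| by rewrite normr_gt0.
  rewrite refl_kernelZ ?invr_gt0// scalerA invX_pred ?gt_eqF// exprVn invrK.
  rewrite -mulrA [_ * (_ / _)]mulrCA mulfV ?gt_eqF// mulr1.
  by rewrite mulVf ?scale1r// expf_neq0// gt_eqF.
have ann y h : y != 0 -> `|h| <= `|y| / 2 -> annulus (`|y|^-1 *: (y + h)).
  move=> y0 hy; have ny0 : 0 < `|y| by rewrite normr_gt0.
  rewrite /annulus normrZ normfV normr_id ler_pdivlMl// ler_pdivrMl//.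
  have := ler_normD y h; have := lerB_normD y h; lra.
split=> [y y0|y h y0 hy].
  rewrite (hom _ y0) normrZ mulrC (@ger0_norm _ (_^-1)) ?invr_ge0 ?exprn_ge0//.
  rewrite ler_wpM2r ?invr_ge0 ?exprn_ge0//.
  have h0 : `|0 : V| <= `|y| / 2 by rewrite normr0 divr_ge0.
  have := ann _ _ y0 h0; rewrite addr0 => yA.
  by have [] := pK _ _ yA yA.
rewrite (hom _ y0 (y + h)) (hom _ y0 y) -scalerBr normrZ.
rewrite (@ger0_norm _ (_^-1)) ?invr_ge0 ?exprn_ge0//.
have h0 : `|0 : V| <= `|y| / 2 by rewrite normr0 divr_ge0.
have := ann _ _ y0 h0; rewrite addr0 => yA.
have [_ ] := pK _ _ (ann _ _ y0 hy) yA.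
rewrite -scalerBr [y + h]addrC addrK normrZ normfV normr_id => le1.
apply: (le_trans (ler_wpM2l _ le1)); first by rewrite invr_ge0 exprn_ge0.
rewrite invX_pred ?normr_eq0// le_eqVlt; apply/orP; left; apply/eqP.
by field; rewrite expf_neq0 normr_eq0.
Qed.

End KernelEstimates.

#[local] Existing Instance summability.totally_filter.

(** * Dominated sums over finite index sets and termwise differentiation *)

Section UnconditionalSums.
Variables (R : realType) (I : choiceType) (W : completeNormedModType R).
Local Notation totally := (@summability.totally I).

Lemma sum_fsetD (Z : zmodType) (F : I -> Z) (A B : {fset I}) : (A `<=` B)%fset ->
  \sum_(m <- B) F m = \sum_(m <- A) F m + \sum_(m <- (B `\` A)%fset) F m.
Proof.
move=> /fsubsetP AB; rewrite (big_fsetID _ (mem A)) /=; congr (_ + _).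
  by congr bigop; congr enum_fset; apply/fsetP => m; rewrite !inE /= andb_idl// => /AB.
by congr bigop; congr enum_fset; apply/fsetP => m; rewrite !inE /= andbC.
Qed.

Lemma sum_fset_le (F : I -> R) (A B : {fset I}) : (forall m, 0 <= F m) -> (A `<=` B)%fset ->
  \sum_(m <- A) F m <= \sum_(m <- B) F m.
Proof. by move=> F0 AB; rewrite (sum_fsetD _ AB) lerDl sumr_ge0. Qed.

Lemma totally_fsupset (A : {fset I}) : \forall S \near totally, (A `<=` S)%fset.
Proof. by exists A. Qed.

Definition dominating (b : I -> R) : Prop :=
  (forall m, 0 <= b m) /\ exists M, forall S : {fset I}, \sum_(m <- S) b m <= M.

(** Take [A] whose sum is within [e] of the supremum of all finite sums. *)
Lemma dominating_tail b : dominating b -> forall e, 0 < e -> exists A : {fset I},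
  forall S : {fset I}, (forall m, m \in S -> m \notin A) -> \sum_(m <- S) b m <= e.
Proof.
move=> [b0 [M bM]] e e0; pose E := [set \sum_(m <- S) b m | S in [set: {fset I}]].
have supE : has_sup E.
  split; first by exists (\sum_(m <- fset0) b m), fset0.
  by exists M => _ [S _ <-].
have [_ [A _ <-] Ae] := sup_adherent e0 supE; exists A => S SA.
have : \sum_(m <- (A `|` S)%fset) b m <= sup E.
  by apply: ub_le_sup; [exact: supE.2|exists (A `|` S)%fset].
rewrite (sum_fsetD _ (fsubsetUl A S)).
have -> : ((A `|` S) `\` A)%fset = S.
  apply/fsetP => m; rewrite !inE; case: (boolP (m \in S)) => [/SA -> //|_].
    by rewrite orbT.
  by rewrite orbF; case: (m \in A).
by move: Ae; set sA := \sum_(m <- A) b m; set sS := \sum_(m <- S) b m; lra.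
Qed.

Definition fsum (Z : zmodType) (f : I -> Z) (S : {fset I}) : Z := \sum_(m <- S) f m.

Lemma cvg_normr_le (T : Type) (F : set_system T) {FF : ProperFilter F} (f : T -> W) a e :
  f @ F --> a -> (\forall t \near F, `|f t| <= e) -> `|a| <= e.
Proof.
move=> fa fe; have na : (fun t => `|f t|) @ F --> `|a| by exact: cvg_norm.
by rewrite -(cvg_lim (@norm_hausdorff R R) na); apply: limr_le => //; apply/cvg_ex; exists `|a|.
Qed.

Definition usum (f : I -> W) : W := lim (fsum f @ totally).

Section Dominated.
Variables (b : I -> R) (Y : Type) (X : set Y) (f : I -> Y -> W) (A0 : {fset I}).
Hypothesis bsum : dominating b.
Hypothesis fb : forall m y, m \notin A0 -> X y -> `|f m y| <= b m.

(** The finite set [A0], where no bound is available, is contained in both index sets and cancels in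
    the difference. *)
Lemma dominated_cauchy e : 0 < e -> exists A : {fset I},
  forall S S' : {fset I}, (A `<=` S)%fset -> (A `<=` S')%fset -> forall y, X y ->
    `|fsum (f^~ y) S - fsum (f^~ y) S'| <= e.
Proof.
move=> e0; have e20 : 0 < e / 2 by rewrite divr_gt0.
have [A1 tailA] := dominating_tail bsum e20.
pose A := (A0 `|` A1)%fset; exists A => S S' AS AS' y Xy.
have tl T : (A `<=` T)%fset -> `|\sum_(m <- (T `\` A)%fset) f m y| <= e / 2.
  move=> AT; apply: (le_trans (ler_norm_sum _ _ _)).
  apply: (@le_trans _ _ (\sum_(m <- (T `\` A)%fset) b m)).
    rewrite !big_seq; apply: ler_sum => m; rewrite !inE negb_or => /andP[/andP[mA0 _] _].
    exact: fb.
  by apply: tailA => m; rewrite !inE negb_or => /andP[/andP[]].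
rewrite /fsum (sum_fsetD _ AS) (sum_fsetD _ AS') opprD addrACA subrr add0r.
by rewrite (le_trans (ler_normB _ _))// [e]splitr lerD// tl.
Qed.

Lemma dominated_fsum_cvg y : X y -> fsum (f^~ y) @ totally --> usum (f^~ y).
Proof.
move=> Xy; apply: cauchy_cvg; apply: cauchy_exP => e e0.
have e20 : 0 < e / 2 by rewrite divr_gt0.
have [A HA] := dominated_cauchy e20.
exists (fsum (f^~ y) A); exists A => // S /= AS.
rewrite /= -ball_normE /=; apply: le_lt_trans (HA _ _ (fsubset_refl A) AS y Xy) _.
by rewrite ltr_pdivrMr// ltr_pMr// ltr1n.
Qed.

Lemma dominated_fsum_uniform e : 0 < e -> \forall S \near totally, forall y, X y ->
  `|usum (f^~ y) - fsum (f^~ y) S| <= e.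
Proof.
move=> e0; have [A HA] := dominated_cauchy e0; exists A => // S /= AS y Xy.
have cv : (fun S' => fsum (f^~ y) S' - fsum (f^~ y) S) @ totally
    --> usum (f^~ y) - fsum (f^~ y) S.
  by apply: cvgB; [exact: dominated_fsum_cvg|exact: cvg_cst].
apply: cvg_normr_le cv _; exists A => // S' /= AS'.
exact: HA.
Qed.

End Dominated.

(* Tannery's argument: the difference quotients, extended by the derivative at *)
(* t = 0, are dominated uniformly in t.                                        *)
Lemma is_derive_usum (V : normedModType R) (f : I -> V -> W) (df : I -> W) (b : I -> R)
    (A0 : {fset I}) (x v : V) (r : R) : dominating b -> 0 < r ->
    (forall t, `|t| <= r ->
       fsum (f^~ (t *: v + x)) @ totally --> usum (f^~ (t *: v + x))) ->
    (forall m t, m \notin A0 -> `|t| <= r ->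
       `|f m (t *: v + x) - f m x| <= `|t| * b m) ->
    (forall m, is_derive x v (f m) (df m)) ->
  is_derive x v (fun y => usum (f^~ y)) (usum df) /\
  fsum df @ totally --> usum df.
Proof.
move=> bsum r0 fcv fb fd.
pose q (m : I) (t : R) : W := if t == 0 then df m else t^-1 *: (f m (t *: v + x) - f m x).
have qcv m : q m @ 0^' --> df m.
  have : (fun t => t^-1 *: (f m (t *: v + x) - f m x)) @ 0^' --> df m.
    by case: (fd m) => fdm <-; exact: fdm.
  apply: cvg_trans; apply: near_eq_cvg; near=> t.
  by rewrite /q ifN//; near: t; exact: nbhs_dnbhs_neq.
have qb0 m t : m \notin A0 -> `|t| <= r -> t != 0 -> `|q m t| <= b m.
  move=> mA tr t0; rewrite /q (negPf t0) normrZ normfV ler_pdivrMl ?normr_gt0//.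
  exact: fb.
have qb m t : m \notin A0 -> `|t| <= r -> `|q m t| <= b m.
  move=> mA tr; have [t0|] := eqVneq t 0; last exact: qb0.
  (* At t = 0 the bound is inherited from the nonzero quotients in the limit. *)
  rewrite t0 /q eqxx.
  apply: (cvg_normr_le (f := q m) (F := 0^')); first exact: qcv.
  near=> s; apply: qb0 => //.
    by near: s; apply: dnbhs0_le.
  by near: s; exact: nbhs_dnbhs_neq.
have [dcv dun] : (forall t, `|t| <= r -> fsum (q^~ t) @ totally --> usum (q^~ t))
  /\ (forall e, 0 < e -> \forall S \near totally, forall t, `|t| <= r ->
  `|usum (q^~ t) - fsum (q^~ t) S| <= e).
  split=> [t tr|e e0].
    exact: (dominated_fsum_cvg (X := [set t | `|t| <= r]) bsum (A0 := A0)).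
  exact: (dominated_fsum_uniform (X := [set t | `|t| <= r]) bsum (A0 := A0)).
have q0 : q^~ 0 = df by apply/funext => m; rewrite /q eqxx.
have dfcv : fsum df @ totally --> usum df.
  by have := dcv 0; rewrite normr0 q0; apply; exact: ltW.
split=> //.
have Qcv : (fun t : R => usum (q^~ t)) @ 0^' --> usum df.
  apply/cvgrPdist_le => e e0.
  have e30 : 0 < e / 3 by rewrite divr_gt0.
  have [S /= dS] := filter_ex (dun _ e30).
  have Scv : (fun t => fsum (q^~ t) S) @ 0^' --> fsum df S.
    by apply: cvg_bigsum => m _; exact: qcv.
  near=> t.
  have tr : `|t| <= r by near: t; apply: dnbhs0_le.
  have d1 := dS 0; rewrite q0 normr0 in d1.
  have d2 : `|fsum df S - fsum (q^~ t) S| <= e / 3 by near: t; exact: cvgr_dist_le Scv _ e30.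
  have d3 := dS t tr; rewrite distrC in d3.
  have -> : usum df - usum (q^~ t) = (usum df - fsum df S) +
      (fsum df S - fsum (q^~ t) S) + (fsum (q^~ t) S - usum (q^~ t)).
    by rewrite !addrA !subrK.
  have -> : e = e / 3 + e / 3 + e / 3 by lra.
  rewrite (le_trans (ler_normD _ _))// lerD// (le_trans (ler_normD _ _))// lerD//.
  exact: d1 (ltW r0).
have : (fun t : R => t^-1 *: (usum (f^~ (t *: v + x)) - usum (f^~ x))) @ 0^' --> usum df.
  move: Qcv; apply: cvg_trans; apply: near_eq_cvg; near=> t.
  have tr : `|t| <= r by near: t; apply: dnbhs0_le.
  have t0 : t != 0 by near: t; exact: nbhs_dnbhs_neq.
  suff h : fsum (q^~ t) @ totally --> t^-1 *: (usum (f^~ (t *: v + x)) - usum (f^~ x)).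
    exact: (cvg_unique (@norm_hausdorff R W) (dcv t tr) h).
  have xcv := fcv 0; rewrite normr0 scale0r add0r in xcv.
  have -> : fsum (q^~ t) =
      (fun S => t^-1 *: (fsum (f^~ (t *: v + x)) S - fsum (f^~ x) S)).
    apply/funext => S; rewrite /fsum -sumrB scaler_sumr; apply: eq_bigr => m _.
    by rewrite /q (negPf t0).
  by apply: cvgZr; apply: cvgB; [exact: fcv|exact: xcv (ltW r0)].
move=> cv; apply: DeriveDef; first by apply/cvg_ex; exists (usum df); exact: cv.
exact: (cvg_lim _ cv).
Unshelve. all: by end_near. Qed.

End UnconditionalSums.

(** * Boxes in Z^l and summability of |m|^(-l-1) *)

Section LatticeBoxes.
Variables (R : realType) (n l : nat).
Hypothesis ln : (l <= n)%N.
Local Notation V := 'rV[R]_n.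
Local Notation L := 'rV[int]_l.
Implicit Types (m p : L) (x : V).

Lemma latt_widen m (i : 'I_l) : latt R n m 0 (widen_ord ln i) = (m 0 i)%:~R.
Proof.
rewrite /latt summxE (bigD1 i)//= !mxE eqxx mulr1 big1 ?addr0// => j ji.
by rewrite !mxE /= val_eqE eq_sym (negPf ji) mulr0.
Qed.

Lemma latt_coord0 m (j : 'I_n) : (l <= j)%N -> latt R n m 0 j = 0.
Proof.
move=> lj; rewrite /latt summxE big1// => i _; rewrite !mxE.
by rewrite gtn_eqF ?mulr0// (leq_trans (ltn_ord i) lj).
Qed.

Lemma latt0 : latt R n (0 : L) = 0.
Proof. by rewrite /latt big1// => i _; rewrite mxE scale0r. Qed.

Lemma latt_coord_le m i : `|(m 0 i)%:~R : R| <= `|latt R n m|.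
Proof. by rewrite -latt_widen; exact: normr_coord. Qed.

Lemma latt_norm_le m (t : R) : 0 <= t ->
  (`|latt R n m| <= t) = [forall i, `|(m 0 i)%:~R : R| <= t].
Proof.
move=> t0; apply/idP/forallP => [mt i|mt]; first exact: le_trans (latt_coord_le m i) mt.
rewrite [leLHS]/Num.Def.normr/= mx_normrE (bigmax_le _ t0)// => -[i j] _ /=.
rewrite (ord1 i); have [lj|jl] := leqP l j; first by rewrite latt_coord0 ?normr0.
by have := mt (Ordinal jl); rewrite -latt_widen; congr (`|latt _ _ _ _ _| <= _); exact: val_inj.
Qed.

Definition boxpt N (f : {ffun 'I_l -> 'I_(2 * N).+1}) : L := \row_i ((f i : nat)%:Z - N%:Z).

Definition box (N : nat) : {fset L} :=
  [fset boxpt f | f in {: {ffun 'I_l -> 'I_(2 * N).+1}}]%fset.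

Lemma in_box N m : (m \in box N) = (`|latt R n m| <= N%:R).
Proof.
rewrite latt_norm_le//; apply/imfsetP/forallP => /= [[f _ ->] i|mN].
  rewrite mxE -intr_norm -[N%:R]/(N%:Z%:~R) ler_int.
  by have := ltn_ord (f i); lia.
have mN' i : (`|(m 0 i + N%:Z)%R| < (2 * N).+1)%N.
  have := mN i; rewrite -intr_norm -[N%:R]/(N%:Z%:~R) ler_int; lia.
exists [ffun i => Ordinal (mN' i)] => //; apply/rowP => i; rewrite mxE ffunE /=.
by have := mN i; rewrite -intr_norm -[N%:R]/(N%:Z%:~R) ler_int; lia.
Qed.

Lemma card_box N : #|` box N| = ((2 * N).+1 ^ l)%N.
Proof.
clear ln; rewrite card_imfset /=; first by rewrite -cardE card_ffun !card_ord.
move=> f g /rowP fg; apply/ffunP => i; apply/val_inj => /=.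
by have := fg i; rewrite !mxE; lia.
Qed.

Lemma box_cofinal (A : {fset L}) : exists N0, forall N, (N0 <= N)%N -> (A `<=` box N)%fset.
Proof.
exists (\sum_(m <- A) Num.truncn `|latt R n m|).+1 => N AN.
apply/fsubsetP => m mA; rewrite in_box; apply: ltW.
apply: (@lt_le_trans _ _ (Num.truncn `|latt R n m|).+1%:R).
  by rewrite truncnS_gt.
rewrite ler_nat (leq_trans _ AN)// ltnS.
by rewrite (big_fsetD1 m)//= leq_addr.
Qed.

Lemma le_box N N' : (N <= N')%N -> (box N `<=` box N')%fset.
Proof.
move=> NN; apply/fsubsetP => m; rewrite !in_box => /le_trans; apply.
by rewrite ler_nat.
Qed.

Lemma sum_fset_const (I : choiceType) (A : {fset I}) (f : I -> R) (c : R) :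
  (forall i, i \in A -> f i <= c) -> \sum_(i <- A) f i <= #|` A|%:R * c.
Proof.
move=> fc; apply: (@le_trans _ _ (\sum_(i <- A) c)).
  by rewrite !big_seq; apply: ler_sum => i; exact: fc.
by rewrite big_const_seq count_predT iter_addr_0 mulr_natl.
Qed.

(** The maximum with 1 only affects m = 0, since other lattice points have sup norm at least 1. *)
Definition latt_weight m : R := (Num.max 1 `|latt R n m| ^+ l.+1)^-1.

(* The shell 2^J < |m| <= 2^(J+1) contributes at most 5^l 2^(-J). *)
Lemma sum_weight_box J :
  \sum_(m <- box (2 ^ J)) latt_weight m <= 5 ^+ l * (3 - 2 * (2 ^+ J)^-1).
Proof.
have wpos m : 0 < Num.max 1 `|latt R n m| by rewrite lt_max ltr01.
(* [3 - 2 * (2 ^+ J)^-1] is 1, for the unit box, plus the geometric sum of 2^(-j) over j < J. *)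
elim: J => [|J IH].
  rewrite expr0 invr1 mulr1 (_ : 3 - 2 = 1 :> R) ?mulr1; last by lra.
  apply: (@le_trans _ _ (#|` box 1|%:R * 1)).
    apply: sum_fset_const => m _; rewrite /latt_weight invf_le1 ?exprn_gt0//.
    by rewrite exprn_ege1// le_max lexx.
  rewrite mulr1 card_box natrX; apply: lerXn2r; rewrite ?nnegrE//.
  by rewrite ler_nat.
have sub : (box (2 ^ J) `<=` box (2 ^ J.+1))%fset by apply: le_box; rewrite leq_exp2l.
rewrite (sum_fsetD _ sub).
have : \sum_(m <- (box (2 ^ J.+1) `\` box (2 ^ J))%fset) latt_weight m <= 5 ^+ l * (2 ^+ J)^-1.
  have pJ : 0 < (2 : R) ^+ J by rewrite exprn_gt0.
  have pJ1 : 1 <= (2 : R) ^+ J by rewrite exprn_ege1// ler1n.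
  apply: (@le_trans _ _ (#|` box (2 ^ J.+1) `\` box (2 ^ J)|%:R * ((2 ^+ J) ^+ l.+1)^-1)%fset).
    apply: sum_fset_const => m; rewrite !inE !in_box -ltNge => /andP[mJ _].
    rewrite /latt_weight lef_pV2 ?posrE ?exprn_gt0//.
    apply: lerXn2r; rewrite ?nnegrE ?(ltW pJ) ?(ltW (wpos _))//.
    by rewrite le_max -natrX (ltW mJ) orbT.
  apply: (@le_trans _ _ ((5 * 2 ^+ J) ^+ l * ((2 ^+ J) ^+ l.+1)^-1)).
    rewrite ler_wpM2r ?invr_ge0 ?exprn_ge0 ?(ltW pJ)//.
    apply: (@le_trans _ _ (#|` box (2 ^ J.+1)|%:R)).
      by rewrite ler_nat; apply: fsubset_leq_card; exact: fsubsetDl.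
    rewrite card_box natrX; apply: lerXn2r; rewrite ?nnegrE ?mulr_ge0 ?(ltW pJ)//.
    rewrite -natr1 natrM natrX exprS; lra.
  rewrite exprMn -mulrA ler_wpM2l ?exprn_ge0// exprS invfM mulrCA.
  by rewrite mulfV ?mulr1// !expf_neq0// gt_eqF.
move: IH; set S1 := \sum_(m <- _) _; set S2 := \sum_(m <- _) _; set q := (2 ^+ J)^-1.
have -> : (2 ^+ J.+1)^-1 = q / 2 :> R by rewrite exprS invfM mulrC.
move=> h1 h2; apply: (le_trans (lerD h1 h2)).
by rewrite -mulrDr ler_wpM2l ?exprn_ge0//; lra.
Qed.

Lemma dominating_latt_weight : dominating latt_weight.
Proof.
have w0 m : 0 <= latt_weight m by rewrite invr_ge0 exprn_ge0// le_max ler01.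
split=> //; exists (5 ^+ l * 3) => S.
have [N0 SN] := box_cofinal S.
have SN' : (S `<=` box (2 ^ N0))%fset by apply: SN; apply: ltnW; exact: ltn_expl.
apply: (le_trans (sum_fset_le w0 SN')); apply: (le_trans (sum_weight_box N0)).
by rewrite ler_wpM2l ?exprn_ge0// gerBl mulr_ge0// invr_ge0 exprn_ge0.
Qed.

Lemma dominatingZ (I : choiceType) (b : I -> R) c : 0 <= c -> dominating b ->
  dominating (fun i => c * b i).
Proof.
move=> c0 [b0 [M bM]]; split=> [i|]; first exact: mulr_ge0.
by exists (c * M) => S; rewrite -mulr_sumr ler_wpM2l.
Qed.

Lemma half_lattice0 : half_lattice (0 : L) = false.
Proof. by apply/existsP => -[j]; rewrite mxE ltxx. Qed.

(** Membership is decided by the sign of the last nonzero coordinate, which negation reverses. *)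
Lemma half_latticeN m : m != 0 -> half_lattice (- m) = ~~ half_lattice m.
Proof.
move=> m0; have [i0 mi0] : exists i, m 0 i != 0.
  apply/existsP; apply: contraNT m0; rewrite negb_exists => /forallP m0.
  by apply/eqP/rowP => i; rewrite mxE; apply/eqP; rewrite -[_ == _]negbK m0.
case: (@arg_maxnP _ i0 (fun i => m 0 i != 0) (fun i => i : nat) mi0) => j mj jmax.
have zero (i : 'I_l) : (j < i)%N -> m 0 i = 0.
  by move=> ji; apply/eqP; apply: contraTT ji => mi; rewrite -leqNgt; exact: jmax.
have half p : (forall i, (p 0 i == 0) = (m 0 i == 0)) -> half_lattice p = (0 < p 0 j).
  move=> pm; apply/existsP/idP => [[i /andP[pi /forallP p0]]|pj].
    have [ij|ji|/val_inj <-//] := ltngtP i j.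
      by have := p0 j; rewrite ij pm (negPf mj).
    by move: pi; have := zero i ji => /eqP; rewrite -pm => /eqP ->; rewrite ltxx.
  exists j; rewrite pj; apply/forallP => i; apply/implyP => ji.
  by rewrite pm zero.
rewrite (half m)// (half (- m)) => [|i]; last by rewrite mxE oppr_eq0.
by rewrite mxE oppr_gt0 -leNgt le_eqVlt (negPf mj).
Qed.

Lemma big_boxN (Z : zmodType) (F : L -> Z) N :
  \sum_(m <- box N) F (- m) = \sum_(m <- box N) F m.
Proof.
have BN : box N = [fset (- m : L) | m in box N]%fset.
  apply/fsetP => m; apply/idP/imfsetP => /= [mN|[p pN ->]].
    by exists (- m); rewrite ?opprK//; move: mN; rewrite !in_box lattN normrN.
  by move: pN; rewrite !in_box lattN normrN.
rewrite [in LHS]BN big_imfset /=; last by move=> m p _ _; exact: oppr_inj.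
by apply: eq_bigr => m _; rewrite opprK.
Qed.

End LatticeBoxes.

(** * Lattice sums of an odd kernel: convergence, derivatives, periodicity *)

Section LatticeKernelSums.
Variables (R : realType) (n l : nat) (W : completeNormedModType R).
Hypotheses (n1 : (1 < n)%N) (ln : (l < n)%N).
Local Notation V := 'rV[R]_n.
Local Notation L := 'rV[int]_l.
Local Notation totally := (@summability.totally L).
Variables (phi : V -> W) (K : R).
Hypothesis K0 : 0 <= K.
Hypothesis phi_bound : forall y, y != 0 -> `|phi y| <= K * (`|y| ^+ n.-1)^-1.
Hypothesis phi_lip : forall y h, y != 0 -> `|h| <= `|y| / 2 ->
  `|phi (y + h) - phi y| <= K * `|h| * (`|y| ^+ n)^-1.
Hypothesis phiN : forall y, phi (- y) = - phi y.
Implicit Types (m p : L) (x y h : V).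
Let ln' : (l <= n)%N := ltnW ln.

(** In the paired case the series over the half lattice is extended by zero terms to all of Z^l, so
    that both cases are sums over the same index set. *)
Definition lterm m x : W :=
  if (l <= n - 2)%N then phi (x + latt R n m)
  else if m == 0 then phi x
  else if half_lattice m then phi (x + latt R n m) + phi (x - latt R n m) else 0.

Lemma invX_le (mu t : R) a e : 1 <= mu -> mu / 2 <= t -> (a <= e <= n)%N ->
  (t ^+ e)^-1 <= 2 ^+ n * (mu ^+ a)^-1.
Proof.
move=> mu1 mut /andP[le en]; have mu0 : 0 < mu by exact: lt_le_trans ltr01 mu1.
apply: (@le_trans _ _ (((mu / 2) ^+ e)^-1)).
  have m20 : 0 < mu / 2 by rewrite divr_gt0.
  rewrite lef_pV2 ?posrE ?exprn_gt0//; last exact: lt_le_trans mut.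
  by apply: lerXn2r; rewrite ?nnegrE ?(ltW m20)// (le_trans (ltW m20)).
rewrite expr_div_n invfM invrK mulrC; apply: ler_pM; rewrite ?invr_ge0 ?exprn_ge0 ?(ltW mu0)//.
  by rewrite ler_eXn2l// ltr1n.
by rewrite lef_pV2 ?posrE ?exprn_gt0// ler_weXn2l.
Qed.

Lemma far_norm (rho : R) x z : `|x| <= rho -> 4 * rho <= `|z| -> `|z| / 2 <= `|x + z|.
Proof.
move=> xr r1; have := lerB_normD z x; rewrite [z + x]addrC.
by have := normr_ge0 x; have := normr_ge0 z; lra.
Qed.

Lemma far_neq0 (rho : R) x z : `|x| <= rho -> 4 * rho <= `|z| -> 1 <= `|z| -> x + z != 0.
Proof.
move=> xr r1 z1; rewrite -normr_gt0; apply: lt_le_trans (far_norm xr r1).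
by rewrite divr_gt0//; lra.
Qed.

Lemma far_bound (rho : R) x z : `|x| <= rho -> 4 * rho <= `|z| -> 1 <= `|z| ->
  (l <= n - 2)%N -> `|phi (x + z)| <= K * (2 ^+ n * (`|z| ^+ l.+1)^-1).
Proof.
move=> xr r1 z1 ln2; apply: (le_trans (phi_bound (far_neq0 xr r1 z1))).
rewrite ler_wpM2l//; apply: invX_le => //; first exact: far_norm xr r1.
by move: n1 ln2; clear; lia.
Qed.

Lemma far_lip (rho : R) x z h : `|x| <= rho -> 4 * rho <= `|z| -> 1 <= `|z| -> `|h| <= rho ->
  `|phi (x + z + h) - phi (x + z)| <= K * `|h| * (2 ^+ n * (`|z| ^+ l.+1)^-1).
Proof.
move=> xr r1 z1 hr; have f := far_norm xr r1.
apply: (le_trans (phi_lip (far_neq0 xr r1 z1) _)).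
  by have := normr_ge0 x; lra.
by rewrite ler_wpM2l ?mulr_ge0//; apply: invX_le => //; rewrite ln leqnn.
Qed.

(** For l <= n - 2 the decay of [phi] suffices; for l = n - 1 one has n = l + 1, and the pair is
    controlled by the Lipschitz bound. *)
Lemma lterm_bounds (rho : R) : 0 <= rho -> exists N c, 0 <= c /\
  forall m x, m \notin box l N -> `|x| <= rho ->
    `|lterm m x| <= c * latt_weight R n m /\
    forall h, `|h| <= rho -> `|lterm m (x + h) - lterm m x| <= `|h| * (c * latt_weight R n m).
Proof.
move=> rho0; exists (Num.truncn (4 * rho)).+1, (K * 2 ^+ n * (2 + 2 * rho)).
have c0 : 0 <= K * 2 ^+ n * (2 + 2 * rho) by rewrite !mulr_ge0 ?addr_ge0 ?mulr_ge0.
split=> // m x; rewrite (in_box R ln') -ltNge => mN xr.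
set z := latt R n m.
have r1 : 4 * rho <= `|z|.
  by apply: ltW; apply: lt_trans mN; exact: truncnS_gt.
have z1 : 1 <= `|z| by apply: ltW; apply: le_lt_trans mN; rewrite ler1n.
have m0 : m != 0.
  by apply: contraTneq z1 => m0; rewrite /z m0 (latt0 R n l) normr0 -ltNge.
have -> : latt_weight R n m = (`|z| ^+ l.+1)^-1 by rewrite /latt_weight max_r.
have wz0 : 0 <= (`|z| ^+ l.+1)^-1 by rewrite invr_ge0 exprn_ge0.
set w := (`|z| ^+ l.+1)^-1 in wz0 *.
have w20 : 0 <= 2 ^+ n * w by rewrite mulr_ge0.
have Kw0 : 0 <= K * 2 ^+ n * w by rewrite mulr_ge0 ?mulr_ge0.
have lip s h : s = z \/ s = - z -> `|h| <= rho ->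
    `|phi (x + s + h) - phi (x + s)| <= K * `|h| * (2 ^+ n * w).
  move=> [] -> hr; first exact: (far_lip xr r1 z1).
  by have := @far_lip rho x (- z) h; rewrite normrN; exact.
rewrite /lterm (negPf m0); case: ifPn => ln2; [|case: ifPn => _]; split.
- apply: (le_trans (far_bound xr r1 z1 ln2)).
  have : 0 <= (K * 2 ^+ n * w) * (1 + 2 * rho) by rewrite mulr_ge0// addr_ge0// mulr_ge0.
  rewrite -/w; lra.
- move=> h hr; rewrite addrAC; apply: (le_trans (lip z h (or_introl erefl) hr)).
  have : 0 <= `|h| by []. move: `|h| => a a0.
  have : 0 <= a * (K * 2 ^+ n * w) * (1 + 2 * rho) by rewrite !mulr_ge0// addr_ge0// mulr_ge0.
  lra.
(* By oddness phi(x - z) = -phi(z - x), so both values are compared with phi(z). *)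
- have -> : phi (x + z) + phi (x - z) = (phi (0 + z + x) - phi (0 + z)) -
     (phi (0 + z + (- x)) - phi (0 + z)).
    by rewrite add0r opprB addrA subrK [z + x]addrC -[z - x]opprB phiN opprK.
  have zr : `|0 : V| <= rho by rewrite normr0.
  have h1 := far_lip zr r1 z1 xr.
  have xr' : `|- x| <= rho by rewrite normrN.
  have h2 := far_lip zr r1 z1 xr'; rewrite normrN in h2.
  apply: (le_trans (ler_normB _ _)); apply: (le_trans (lerD h1 h2)).
  have : 0 <= (rho - `|x|) * (K * 2 ^+ n * w) by rewrite mulr_ge0// subr_ge0.
  rewrite -/w; lra.
- move=> h hr.
  have -> : phi (x + h + z) + phi (x + h - z) - (phi (x + z) + phi (x - z)) =
     (phi (x + z + h) - phi (x + z)) + (phi (x - z + h) - phi (x - z)).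
    by rewrite opprD addrACA ![x + h + _]addrAC.
  apply: (le_trans (ler_normD _ _)).
  apply: (le_trans (lerD (lip z h (or_introl erefl) hr) (lip _ h (or_intror erefl) hr))).
  have : 0 <= `|h| by []. move: `|h| => a a0.
  have : 0 <= a * (K * 2 ^+ n * w) * (2 * rho) by rewrite !mulr_ge0// mulr_ge0.
  lra.
- by rewrite normr0 !mulr_ge0// addr_ge0// mulr_ge0.
- by move=> h hr; rewrite subrr normr0 !mulr_ge0// addr_ge0// mulr_ge0.
Qed.

Lemma lterm_cvg x : fsum (lterm^~ x) @ totally --> usum (lterm^~ x).
Proof.
have [N [c [c0 cb]]] := lterm_bounds (normr_ge0 x).
apply: (dominated_fsum_cvg (X := [set x]) (A0 := box l N)
  (dominatingZ c0 (dominating_latt_weight R ln'))) => // m y mN ->.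
by have [] := cb m x mN (lexx _).
Qed.

Lemma lterm_uniform rho e : 0 <= rho -> 0 < e -> \forall S \near totally,
  forall x, `|x| <= rho -> `|usum (lterm^~ x) - fsum (lterm^~ x) S| <= e.
Proof.
move=> rho0 e0; have [N [c [c0 cb]]] := lterm_bounds rho0.
apply: (dominated_fsum_uniform (X := [set x | `|x| <= rho]) (A0 := box l N)
  (dominatingZ c0 (dominating_latt_weight R ln'))) => // m y mN yr.
by have [] := cb m y mN yr.
Qed.

Lemma derivable_lterm m x v : ~ lattice R n l x ->
  (forall y, y != 0 -> derivable phi y v) -> derivable (lterm m) x v.
Proof.
move=> xl dphi.
have nz p : x + latt R n p != 0.
  apply/eqP => e; apply: xl; exists (- p) => //.
  by apply/eqP; rewrite lattN eq_sym -subr_eq0 opprK e.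
have sh z : x + z != 0 -> derivable (fun y => phi (y + z)) x v.
  by move=> xz; have [] := is_derive_translate (derivableP (dphi _ xz)).
rewrite /lterm; case: (l <= n - 2)%N; first exact: sh.
case: (m == 0); first by apply: dphi; have := nz 0; rewrite (latt0 R n l) addr0.
case: (half_lattice m); last exact: derivable_cst.
by apply: derivableD; apply: sh => //; have := nz (- m); rewrite lattN.
Qed.

Lemma is_derive_usum_lterm x v : ~ lattice R n l x ->
    (forall y, y != 0 -> derivable phi y v) ->
  is_derive x v (fun y => usum (lterm^~ y)) (usum (fun m => 'D_v (lterm m) x)) /\
  fsum (fun m => 'D_v (lterm m) x) @ totally --> usum (fun m => 'D_v (lterm m) x).
Proof.
move=> xl dphi; pose rho := `|x| + `|v|.
have rho0 : 0 <= rho by rewrite addr_ge0.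
have [N [c [c0 cb]]] := lterm_bounds rho0.
have cv0 : 0 <= c * `|v| by rewrite mulr_ge0.
apply: (is_derive_usum (b := fun m => c * `|v| * latt_weight R n m) (A0 := box l N)
  (r := 1) (dominatingZ cv0 (dominating_latt_weight R ln'))) => //.
- by move=> t _; exact: lterm_cvg.
- move=> m t mN t1; have xr : `|x| <= rho by rewrite lerDl.
  have tv : `|t *: v| <= rho.
    rewrite normrZ; have := ler_wpM2r (normr_ge0 v) t1.
    rewrite mul1r => h; apply: (le_trans h); by rewrite lerDr.
  have [_ /(_ _ tv)] := cb m x mN xr.
  rewrite [x + _]addrC normrZ => h; apply: (le_trans h).
  by rewrite -!mulrA [X in _ <= _ * X]mulrCA lexx.
- by move=> m; apply: derivableP; exact: derivable_lterm.
Qed.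

(** A box is symmetric and splits into 0, the half lattice and its negative, so the pairing can be
    undone there. *)
Lemma fsum_box x N : fsum (lterm^~ x) (box l N) =
  \sum_(m <- box l N) phi (x + latt R n m).
Proof.
rewrite /fsum; case: (boolP (l <= n - 2)%N) => ln2.
  by apply: eq_bigr => m _; rewrite /lterm ln2.
rewrite {1}/lterm (negPf ln2).
have b0 : 0 \in box l N by rewrite (in_box R ln') (latt0 R n l) normr0.
rewrite (big_fsetD1 0)//= eqxx [RHS](big_fsetD1 0)//= (latt0 R n l) addr0; congr (_ + _).
pose c m := (m != 0) && half_lattice m.
have D1 (F : L -> W) : \sum_(m <- (box l N `\ 0)%fset) F m =
   \sum_(m <- box l N) if m == 0 then 0 else F m.
  rewrite [RHS](big_fsetD1 0)//= eqxx add0r; rewrite !big_seq; apply: eq_bigr => m.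
  by rewrite !inE => /andP[/negPf ->].
rewrite !D1.
have -> : \sum_(m <- box l N) (if m == 0 then 0 else phi (x + latt R n m)) =
   \sum_(m <- box l N) ((if half_lattice m then phi (x + latt R n m) else 0)
     + if half_lattice (- m) then phi (x + latt R n m) else 0).
  apply: eq_bigr => m _; case: eqVneq => [->|m0]; first by rewrite oppr0 half_lattice0 addr0.
  by rewrite half_latticeN//; case: (half_lattice m); rewrite ?addr0 ?add0r.
rewrite big_split/= -[X in _ = _ + X](big_boxN R ln')/= -big_split/=; apply: eq_bigr => m _.
rewrite opprK lattN; case: eqVneq => [->|_]; first by rewrite half_lattice0 addr0.
by case: (half_lattice m); rewrite ?addr0.
Qed.

Lemma fsum_box_cvg (f : L -> W) (a : W) : fsum f @ totally --> a ->
  (fun N => fsum f (box l N)) @ \oo --> a.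
Proof.
move=> fa; apply: (@cvg_comp _ _ _ (box l) (fsum f) _ totally) fa => P [A _ AP].
by have [N0 AN] := box_cofinal R ln' A; exists N0 => // N /= /AN; exact: AP.
Qed.

(** The indices of [A] outside the inner box are counted by the difference of the box cardinalities;
    there |x + z| >= N/2, so each term is O(N^(1-n)), hence O(N^(-l)). *)
Lemma sum_box_gap x N M (A : {fset L}) : (0 < N)%N -> 2 * `|x| <= N%:R ->
    (box l N `<=` A)%fset -> (A `<=` box l (N + M))%fset ->
  `|\sum_(m <- A) phi (x + latt R n m) - \sum_(m <- box l N) phi (x + latt R n m)| <=
  K * 2 ^+ n * (((2 * (N + M)).+1%:R / N%:R) ^+ l - ((2 * N).+1%:R / N%:R) ^+ l).
Proof.
move=> N0 xN NA AM; have N0' : 0 < N%:R :> R by rewrite ltr0n.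
rewrite (sum_fsetD _ NA) addrC addKr; apply: (le_trans (ler_norm_sum _ _ _)).
apply: (@le_trans _ _ (#|` A `\` box l N|%:R * (K * (2 ^+ n * (N%:R ^+ l)^-1)))%fset).
  apply: sum_fset_const => m; rewrite !inE (in_box R ln') -ltNge => /andP[Nm _].
  set z := latt R n m in Nm *.
  have xz : N%:R / 2 <= `|x + z|.
    by have := lerB_normD z x; rewrite [z + x]addrC; lra.
  have xz0 : x + z != 0 by rewrite -normr_gt0 (lt_le_trans _ xz)// divr_gt0.
  apply: (le_trans (phi_bound xz0)); rewrite ler_wpM2l//.
  by apply: invX_le => //; [rewrite ler1n|move: ln; clear; lia].
apply: (@le_trans _ _ (((2 * (N + M)).+1%:R ^+ l - (2 * N).+1%:R ^+ l)
    * (K * (2 ^+ n * (N%:R ^+ l)^-1)))).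
  apply: ler_wpM2r; first by rewrite !mulr_ge0// invr_ge0 exprn_ge0// ltW.
  rewrite -!natrX -!card_box -natrB; last first.
    by apply: fsubset_leq_card; apply: (le_box R ln'); rewrite leq_addr.
  rewrite ler_nat cardfsD (fsetIidPr NA) leq_sub2r//.
  exact: fsubset_leq_card.
by rewrite !expr_div_n -mulrBl le_eqVlt; apply/orP; left; apply/eqP; ring.
Qed.

(* A translation changes the sum over a box of radius N only on a layer of     *)
(* O(N^(l-1)) points, where the terms are O(N^(1-n)).                          *)
Lemma usum_lterm_periodic x p :
  usum (lterm^~ (x + latt R n p)) = usum (lterm^~ x).
Proof.
apply/eqP; rewrite -subr_eq0 -normr_le0; apply/ler_addgt0Pr => e e0; rewrite add0r.
pose M := (Num.truncn `|latt R n p|).+1.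
have pM : `|latt R n p| <= M%:R by apply: ltW; exact: truncnS_gt.
(* As [M] bounds |p|, both this box and its translate by p lie between the boxes of radii N + 1 and
   N + 1 + 2M. *)
pose B N := box l (N.+1 + M); pose addp (m : L) : L := m + p.
have Bcv y : (fun N => fsum (lterm^~ y) (B N)) @ \oo --> usum (lterm^~ y).
  have lc := @lterm_cvg y; have := fsum_box_cvg lc; rewrite -(cvg_shiftn M.+1).
  suff -> : (fun N => fsum (lterm^~ y) (B N)) =
    (fun N => fsum (lterm^~ y) (box l (N + M.+1))) by [].
  by apply/funext => N; rewrite /B addnS addSn.
have Dcv : (fun N => fsum (lterm^~ (x + latt R n p)) (B N) - fsum (lterm^~ x) (B N)) @ \oo
    --> usum (lterm^~ (x + latt R n p)) - usum (lterm^~ x) by apply: cvgB; exact: Bcv.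
apply: (cvg_normr_le Dcv).
pose c := K * 2 ^+ n.
(* For fixed [M] both quotients tend to 2, so their powers cancel in the limit. *)
pose d N : R := c * (((2 * (N.+1 + (M + M))).+1%:R / N.+1%:R) ^+ l
                     - ((2 * N.+1).+1%:R / N.+1%:R) ^+ l).
have d0 : d @ \oo --> (0 : R).
  have lim1 (a : R) : (fun N : nat => (2 + a * N.+1%:R^-1) ^+ l) @ \oo --> (2 : R) ^+ l.
    elim: (l) => [|j IH].
      by under eq_fun do rewrite expr0; rewrite expr0; exact: cvg_cst.
    under eq_fun do rewrite exprS; rewrite exprS; apply: cvgM IH.
    rewrite -[X in _ --> X]addr0; apply: cvgD; first exact: cvg_cst.
    rewrite -(mulr0 a); apply: cvgM; [exact: cvg_cst|exact: cvg_harmonic].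
  have -> : d = (fun N => c * ((2 + (4 * M%:R + 1) * N.+1%:R^-1) ^+ l
      - (2 + 1 * N.+1%:R^-1) ^+ l)).
    apply/funext => N; rewrite /d; congr (_ * (_ ^+ _ - _ ^+ _)).
      rewrite -natr1 natrM natrD natrD; field.
      by rewrite addrC natr1 pnatr_eq0.
    rewrite -natr1 natrM; field.
    by rewrite addrC natr1 pnatr_eq0.
  rewrite -(mulr0 c); apply: cvgM; first exact: cvg_cst.
  by rewrite -[X in _ --> X](subrr (2 ^+ l)); apply: cvgB; exact: lim1.
have de : \forall N \near \oo, d N + d N <= e.
  have dd : (fun N => d N + d N) @ \oo --> (0 : R).
    by rewrite -[X in _ --> X](addr0 0); exact: cvgD.
  exact: cvgr_le dd _ e0.
near=> N.
have xN : 2 * `|x| <= N.+1%:R.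
  apply: (@le_trans _ _ N%:R); last by rewrite ler_nat.
  by near: N; exact: nbhs_infty_ger.
rewrite /= /B !fsum_box -/(B N).
have sub1 : (box l N.+1 `<=` B N)%fset by apply: (le_box R ln'); rewrite leq_addr.
have -> : \sum_(m <- B N) phi (x + latt R n p + latt R n m) =
    \sum_(m <- [fset addp m | m in B N]%fset) phi (x + latt R n m).
  rewrite [RHS]big_imfset /=; last by move=> m m' _ _; exact: addIr.
  by apply: eq_bigr => m _; rewrite /addp lattD addrA addrAC.
have sub2 : (B N `<=` box l (N.+1 + (M + M)))%fset.
  by apply: (le_box R ln'); rewrite leq_add2l leq_addr.
have sub3 : (box l N.+1 `<=` [fset addp m | m in B N])%fset.
  apply/fsubsetP => m; rewrite (in_box R ln') => mN; apply/imfsetP.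
  exists (m - p); last by rewrite /addp subrK.
  rewrite /B /= (in_box R ln') lattD lattN natrD (le_trans (ler_normB _ _))//.
  exact: lerD.
have sub4 : ([fset addp m | m in B N] `<=` box l (N.+1 + (M + M)))%fset.
  apply/fsubsetP => _ /imfsetP[m /= mB ->].
  rewrite (in_box R ln') in mB; rewrite /addp (in_box R ln') lattD addnA natrD.
  by rewrite (le_trans (ler_normD _ _))// lerD.
have g1 := sum_box_gap (ltn0Sn N) xN sub1 sub2.
have g2 := sum_box_gap (ltn0Sn N) xN sub3 sub4.
rewrite -[X in `|X|](subrKA (\sum_(m <- box l N.+1) phi (x + latt R n m))).
apply: (le_trans (ler_normD _ _)); rewrite [X in _ + X]distrC.
apply: (le_trans (lerD g2 g1)).
by near: N.
Unshelve. all: by end_near. Qed.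

End LatticeKernelSums.

(** * Completeness of the Clifford algebra; translations and finite sums of monogenic functions *)

HB.instance Definition _ (R : realType) (n : nat) :=
  Complete.copy (Cl R n) 'rV[R]_#|{set 'I_n}|.

Section Translations.
Variables (R : realType) (n : nat).
Local Notation V := 'rV[R]_n.
Local Notation C := (Cl R n).

Lemma dirac_translate (f : V -> C) x z :
  dirac (fun y => f (y + z)) x = dirac f (x + z).
Proof.
rewrite /dirac; apply: eq_bigr => j _; congr (_ * _); rewrite /derive.
suff -> : (fun t : R => t^-1 *: (((fun y => f (y + z)) \o shift x) (t *: stdvec R n j)
       - f (x + z))) =
     (fun t : R => t^-1 *: ((f \o shift (x + z)) (t *: stdvec R n j) - f (x + z))) by [].
by apply/funext => t /=; rewrite addrA.
Qed.

Lemma monogenic_poly_sum k (I : Type) (r : seq I) (p : I -> V -> C) :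
  (forall i, monogenic_poly k (p i)) -> monogenic_poly k (fun u => \sum_(i <- r) p i u).
Proof.
move=> mp; elim: r => [|i r IH].
  by under eq_fun do rewrite big_nil; exact: monogenic_poly0.
by under eq_fun do rewrite big_cons; exact: monogenic_polyD.
Qed.

Lemma dirac_eigen_sum k (I : Type) (r : seq I) (p : I -> V -> C) :
  (forall i, dirac_eigen k (p i)) -> dirac_eigen k (fun u => \sum_(i <- r) p i u).
Proof.
move=> mp; elim: r => [|i r IH].
  by under eq_fun do rewrite big_nil; exact: dirac_eigen0.
by under eq_fun do rewrite big_cons; exact: dirac_eigenD.
Qed.

End Translations.

(** * The cotangent series without its left factor u *)

Section CotangentKernel.
Variables (R : realType) (n l d : nat).
Hypotheses (n3 : (3 <= n)%N) (l_range : (1 <= l <= n - 1)%N).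
Local Notation V := 'rV[R]_n.
Local Notation C := (Cl R n).
Local Notation L := 'rV[int]_l.
Local Notation totally := (@summability.totally L).
Variable p : V -> C.
Hypothesis mp : monogenic_poly d p.

Let n1 : (1 < n)%N := ltnW n3.
Fact l_lt_n : (l < n)%N.
Proof. by move: n3 l_range; clear; lia. Qed.

Let phi u y := refl_kernel p y u.
Let T u (m : L) x : C := lterm (phi u) m x.

Definition cotk x u : C := usum ((T u)^~ x).

(* At y = 0 division by zero gives the value 0, which is monogenic as well;    *)
(* hence lattice points need not be excluded.                                  *)
Lemma monogenic_phi y : monogenic_poly d (fun u => phi u y).
Proof.
have [->|y0] := eqVneq y 0; last exact: monogenic_refl_kernel.
have -> : (fun u => phi u 0) = (fun=> 0) by apply/funext => u; exact: refl_kernel0.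
exact: monogenic_poly0.
Qed.

Lemma monogenic_T m x : monogenic_poly d (fun u => T u m x).
Proof.
rewrite /T /lterm; case: (l <= n - 2)%N; first exact: monogenic_phi.
case: (m == 0); first exact: monogenic_phi.
case: (half_lattice m); last exact: monogenic_poly0.
by apply: monogenic_polyD; exact: monogenic_phi.
Qed.

Lemma phi_bounds u : exists2 K, 0 <= K &
  (forall y, y != 0 -> `|phi u y| <= K * (`|y| ^+ n.-1)^-1) /\
  (forall y h, y != 0 -> `|h| <= `|y| / 2 ->
     `|phi u (y + h) - phi u y| <= K * `|h| * (`|y| ^+ n)^-1).
Proof. by apply: (refl_kernel_bounds (d := d)); [exact: ltnW n1|case: mp]. Qed.

Lemma cotk_cvg x u : fsum ((T u)^~ x) @ totally --> cotk x u.
Proof.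
have [K K0 [b1 b2]] := phi_bounds u.
by apply: (lterm_cvg n1 l_lt_n K0 b1 b2) => y; exact: refl_kernelN.
Qed.

Lemma cotk_uniform u rho e : 0 <= rho -> 0 < e -> \forall S \near totally,
  forall x, `|x| <= rho -> `|cotk x u - fsum ((T u)^~ x) S| <= e.
Proof.
have [K K0 [b1 b2]] := phi_bounds u.
by apply: (lterm_uniform n1 l_lt_n K0 b1 b2) => y; exact: refl_kernelN.
Qed.

Lemma cotk_periodic x u (m : L) : cotk (x + latt R n m) u = cotk x u.
Proof.
have [K K0 [b1 b2]] := phi_bounds u.
by apply: (usum_lterm_periodic n1 l_lt_n K0 b1 b2) => y; exact: refl_kernelN.
Qed.

Lemma monogenic_cotk x : monogenic_poly d (cotk x).
Proof.
apply: (@monogenic_lim R n d _ totally _ (fun S u => fsum ((T u)^~ x) S)).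
  by apply: nearW => S; apply: monogenic_poly_sum => m; exact: monogenic_T.
by move=> u; exact: cotk_cvg.
Qed.

Lemma derivable_phi u v y : y != 0 -> derivable (phi u) y v.
Proof. exact: derivable_refl_kernel mp. Qed.

Lemma is_derive_cotk x u v : ~ lattice R n l x ->
  is_derive x v (fun y => cotk y u) (usum (fun m => 'D_v (T u m) x)) /\
  fsum (fun m => 'D_v (T u m) x) @ totally --> usum (fun m => 'D_v (T u m) x).
Proof.
move=> xl; have [K K0 [b1 b2]] := phi_bounds u.
apply: (is_derive_usum_lterm n1 l_lt_n K0 b1 b2) => // [y|y y0].
  exact: refl_kernelN.
exact: derivable_phi.
Qed.

Lemma dirac_eigen_T m x : ~ lattice R n l x -> dirac_eigen d (fun u => dirac (T u m) x).
Proof.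
move=> xl.
have nz (q : L) : x + latt R n q != 0.
  apply/eqP => e; apply: xl; exists (- q) => //.
  by apply/eqP; rewrite lattN eq_sym -subr_eq0 opprK e.
have ph z : x + z != 0 -> dirac_eigen d (fun u => dirac (fun y => phi u (y + z)) x).
  move=> xz; have -> : (fun u => dirac (fun y => phi u (y + z)) x) =
      (fun u => dirac (phi u) (x + z)).
    by apply/funext => u; exact: dirac_translate.
  exact: dirac_eigen_refl_kernel mp xz.
have dph z : x + z != 0 -> forall u v, derivable (fun y => phi u (y + z)) x v.
  by move=> xz u v; have [] := is_derive_translate (derivableP (@derivable_phi u v _ xz)).
rewrite /T /lterm; case: (l <= n - 2)%N; first exact: ph.
case: (m == 0).
  by apply: dirac_eigen_refl_kernel => //; have := nz 0; rewrite (latt0 R n l) addr0.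
case: (half_lattice m); last first.
  have -> : (fun u => dirac (fun _ : V => 0 : C) x) = (fun _ : V => 0).
    by apply/funext => u; have [_ ->] := monogenic_poly0 R n 0.
  exact: dirac_eigen0.
have nz' : x - latt R n m != 0 by rewrite -lattN.
have -> : (fun u => dirac (fun y => phi u (y + latt R n m) + phi u (y - latt R n m)) x) =
   (fun u => dirac (fun y => phi u (y + latt R n m)) x +
             dirac (fun y => phi u (y - latt R n m)) x).
  by apply/funext => u; rewrite diracD// => j; exact: dph.
by apply: dirac_eigenD; exact: ph.
Qed.

(** D_x passes through the series by [is_derive_cotk], and [dirac_eigen] passes to the limit. *)
Lemma dirac_eigen_cotk x : ~ lattice R n l x ->
  dirac_eigen d (fun u => dirac (fun y => cotk y u) x).
Proof.
move=> xl.
apply: (@dirac_eigen_lim R n d _ totally _ (fun S u => fsum (fun m => dirac (T u m) x) S)).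
  by apply: nearW => S; apply: dirac_eigen_sum => m; exact: dirac_eigen_T.
move=> u; rewrite (dirac_is_derive (fun j => (is_derive_cotk u (stdvec R n j) xl).1)).
have -> : fsum (fun m => dirac (T u m) x) =
    (fun S => \sum_j clgen R j * fsum (fun m => 'D_(stdvec R n j) (T u m) x) S).
  apply/funext => S; rewrite /fsum /dirac exchange_big/=; apply: eq_bigr => j _.
  by rewrite mulr_sumr.
apply: cvg_bigsum => j _; apply: cl_cvgM; first exact: cvg_cst.
exact: (is_derive_cotk u (stdvec R n j) xl).2.
Qed.

Lemma monogenic_dirac_cotk x z : ~ lattice R n l (x + z) ->
  monogenic_poly d.+1 (fun u => dirac (fun y => clvec u * cotk (y + z) u) x).
Proof.
move=> xl; apply: (monogenic_dirac_clvecM (G := fun y => cotk (y + z))).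
- by near=> y; exact: monogenic_cotk.
- by move=> u j; have [] := is_derive_translate (is_derive_cotk u (stdvec R n j) xl).1.
- have -> : (fun u => dirac (fun y => cotk (y + z) u) x) =
      (fun u => dirac (fun y => cotk y u) (x + z)).
    by apply/funext => u; exact: (dirac_translate (fun y => cotk y u)).
  exact: dirac_eigen_cotk.
Unshelve. all: by end_near. Qed.

End CotangentKernel.

(** * Identification of H_k and its partial sums with the reflected kernel *)

Section Cotangents.
Variables (R : realType) (n l k : nat).
Local Notation V := 'rV[R]_n.
Local Notation C := (Cl R n).
Local Notation L := 'rV[int]_l.
Local Notation totally := (@summability.totally L).
Variable Z : V -> V -> C.

(** The f of the outline: the normalizing constant and the right factor v are absorbed, and right
    multiplication preserves left monogenicity. *)
Definition kernel_section (v w : V) : C :=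
  (- 1 / (sphere_area R n * rs_const R n k)) *: (Z w v * clvec v).

Lemma monogenic_kernel_section v : is_reproducing_kernel k.-1 Z ->
  monogenic_poly k.-1 (kernel_section v).
Proof.
move=> [[c ZE] Z0 _ _]; apply: monogenic_polyZ; apply: monogenic_polyMr; split=> [|u].
  exists (fun a => \sum_(b | mdeg b == k.-1) monom b v *: c a b) => u.
  rewrite ZE; apply: eq_bigr => a _; rewrite scaler_sumr; apply: eq_bigr => b _.
  by rewrite scalerA.
exact: Z0.
Qed.

Lemma vecpart_sandwich (x u : V) : x != 0 ->
  vecpart ((enorm x ^+ 2)^-1 *: (clvec x * clvec u * clvec x)) = refl x u.
Proof.
move=> x0; rewrite -[RHS]vecpartK; congr vecpart.
have d0 : dotp x x != 0 by rewrite dotp_eq0.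
have /eqP := clvec_anticomm x u; rewrite -subr_eq0 opprK -addrA addr_eq0 => /eqP ->.
rewrite mulNr mulrDl -mulrA clvec_sqr enorm_sqr mulrN opprD opprK -!scalerAl -!scalerAr.
rewrite mulr1 mul1r scalerDr scalerN !scalerA mulVf// scale1r.
rewrite /refl clvecD -[- (_ *: x)]scaleNr clvecZ scaleNr; congr (_ - _ *: _).
by rewrite mulrC mulr_natl.
Qed.

Lemma RSHE x u v : RSH k Z x u v = clvec u * refl_kernel (kernel_section v) x u.
Proof.
rewrite /RSH /refl_kernel; have [->|x0] := eqVneq x 0.
  have -> : clvec (0 : V) = 0 by rewrite /clvec big1// => i _; rewrite mxE scale0r.
  by rewrite scaler0 mulr0 !mul0r !scaler0 mulr0.
rewrite vecpart_sandwich// /kernel_section.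
set s := - 1 / _; set r := (enorm x ^+ n)^-1.
by rewrite -!(scalerAr, scalerAl) !scalerA [s * r]mulrC !mulrA.
Qed.

(** For l = n - 1 the isolated term H_k(x) of [cot_psum] is present for every [S], whereas [lterm]
    attaches it to the index 0; hence the condition on [S], which holds eventually. *)
Lemma cot_psumE (S : {fset L}) x u v : (0 \in S) ->
  cot_psum k Z S x u v =
  clvec u * fsum (fun m => lterm (fun y => refl_kernel (kernel_section v) y u) m x) S.
Proof.
move=> S0; rewrite /cot_psum /fsum; case: (boolP (l <= n - 2)%N) => ln2.
  by rewrite mulr_sumr; apply: eq_bigr => m _; rewrite /lterm ln2 RSHE.
rewrite [in RHS](big_fsetD1 0)//= {1}/lterm (negPf ln2) eqxx mulrDr RSHE; congr (_ + _).
rewrite big_mkcond (big_fsetD1 0)//= half_lattice0 add0r mulr_sumr !big_seq.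
apply: eq_bigr => m; rewrite !inE => /andP[/negPf m0 _]; rewrite /lterm (negPf ln2) m0.
by case: (half_lattice m); rewrite ?mulr0// mulrDr !RSHE.
Qed.

End Cotangents.

(** * Transfer to the cotangent series and to the cylinder *)

Section MainTheorem.
Variables (R : realType) (n k l : nat).
Hypotheses (n3 : (3 <= n)%N) (k1 : (1 <= k)%N) (l_range : (1 <= l <= n - 1)%N).
Variable Z : 'rV[R]_n -> 'rV[R]_n -> Cl R n.
Hypothesis Zk : is_reproducing_kernel k.-1 Z.
Local Notation V := 'rV[R]_n.
Local Notation C := (Cl R n).
Local Notation L := 'rV[int]_l.
Local Notation totally := (@summability.totally L).

Let G (v x u : V) : C := cotk l (kernel_section k Z v) x u.
Let mZ v := monogenic_kernel_section v Zk.

Lemma near_cot_psum (u v : V) : \forall S \near totally, forall x,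
  cot_psum k Z S x u v = clvec u *
    fsum (fun m => lterm (fun y => refl_kernel (kernel_section k Z v) y u) m x) S.
Proof.
apply: filterS (totally_fsupset [fset (0 : L)]%fset) => S S0 x.
by apply: cot_psumE; apply: (fsubsetP S0); rewrite inE.
Qed.

Lemma cotE (x u v : V) : cot l k Z x u v = clvec u * G v x u.
Proof.
apply: cvg_lim; first exact: norm_hausdorff.
have : (fun S => clvec u * fsum (fun m =>
    lterm (fun y => refl_kernel (kernel_section k Z v) y u) m x) S) @ totally
    --> clvec u * G v x u.
  apply: cl_cvgM; first exact: cvg_cst.
  exact: (cotk_cvg n3 l_range (mZ v)).
apply: cvg_trans; apply: near_eq_cvg.
by apply: filterS (near_cot_psum u v) => S ->.
Qed.

Lemma cot_psum_uniform (u v : V) (K : set V) : compact K ->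
  {uniform K, (fun (S : {fset L}) (x : V) => cot_psum k Z S x u v) @ totally
     --> (fun x : V => cot l k Z x u v)}.
Proof.
move=> /compact_bounded[M [_ KM]] P /uniform_nbhs[E [/= entE EP]].
suff EK : \forall S \near totally, forall y, K y -> E (cot l k Z y u v, cot_psum k Z S y u v).
  by apply: filterS EK => S ES; apply: EP => y; exact: ES.
move: entE; rewrite -entourage_ballE => -[e /= e0 eE].
pose rho := Num.max 0 (M + 1).
have Krho x : K x -> `|x| <= rho.
  move=> Kx; rewrite le_max; apply/orP; right; apply: (KM (M + 1)) => //.
  by rewrite ltrDl.
have rho0 : 0 <= rho by rewrite le_max lexx.
(* Bounds left multiplication by u; the extra 1 keeps it positive, and halving [e] gives the strict
   inequality of the entourage. *)
pose c := clmulK R n * `|clvec u : C| + 1.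
have c0 : 0 < c by rewrite ltr_wpDl// mulr_ge0// clmulK_ge0.
have e1 : 0 < e / 2 / c by rewrite !divr_gt0.
have nu := cotk_uniform n3 l_range (mZ v) u rho0 e1.
near=> S => y Ky; apply: eE; rewrite -ball_normE /=.
have SE : forall x, cot_psum k Z S x u v = clvec u *
    fsum (fun m => lterm (fun y => refl_kernel (kernel_section k Z v) y u) m x) S.
  by near: S; exact: near_cot_psum.
have SB : forall x, `|x| <= rho -> `|G v x u - fsum (fun m =>
    lterm (fun y => refl_kernel (kernel_section k Z v) y u) m x) S| <= e / 2 / c.
  by near: S; exact: nu.
rewrite cotE SE -mulrBr; apply: (le_lt_trans (cl_normrM _ _)); rewrite mulrA.
apply: (@le_lt_trans _ _ (c * (e / 2 / c))).
  by apply: ler_pM; rewrite ?mulr_ge0 ?clmulK_ge0 ?lerDl//; apply: SB; exact: Krho.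
by rewrite mulrC divfK ?gt_eqF// ltr_pdivrMr// ltr_pMr// ltr1n.
Unshelve. all: by end_near. Qed.

Lemma cot_translate (x u v : V) (m : L) :
  cot l k Z (x + latt R n m) u v = cot l k Z x u v.
Proof. by rewrite !cotE /G (cotk_periodic n3 l_range (mZ v)). Qed.

Lemma cot_eq (x y u v : V) : lattice R n l (x - y) -> cot l k Z x u v = cot l k Z y u v.
Proof. by move=> [m _ e]; rewrite -[x](subrK y) -e addrC cot_translate. Qed.

Definition cot' (x' y' : cylinder R n l) (u v : V) : C := cot l k Z (repr x' - repr y') u v.

Lemma lattice_repr (x : V) : lattice R n l (repr (cyl_pi l x) - x).
Proof. by apply/cyl_piP; rewrite {1}/cyl_pi reprK. Qed.

Lemma cot'_pi (x : V) y' u v : cot' (cyl_pi l x) y' u v = cot l k Z (x - repr y') u v.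
Proof.
apply: cot_eq; rewrite opprB addrA subrK; exact: lattice_repr.
Qed.

Lemma not_latticeB (x' y' : cylinder R n l) : x' <> y' -> ~ lattice R n l (repr x' - repr y').
Proof. by move=> xy /cyl_piP; rewrite /cyl_pi !reprK. Qed.

End MainTheorem.

(** Membership in u M_(k-1) and derivability accompany the last equation so that Q_k is applied
    where it is defined and its derivatives are genuine. *)
Theorem mainTheorem8 (R : realType) (n k l : nat)
    (n_ge3 : (3 <= n)%N) (k_ge1 : (1 <= k)%N) (l_range : (1 <= l <= n - 1)%N)
    (Z : 'rV[R]_n -> 'rV[R]_n -> Cl R n)
    (Z_kernel : is_reproducing_kernel k.-1 Z) :
  [/\ forall (u v : 'rV[R]_n) (K : set 'rV[R]_n),
        compact K -> K `<=` ~` lattice R n l ->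
        {uniform K, (fun (S : {fset 'rV[int]_l}) (x : 'rV[R]_n) =>
                       cot_psum k Z S x u v) @ summability.totally
                    --> (fun x : 'rV[R]_n => cot l k Z x u v)},
      forall (x u v : 'rV[R]_n) (m : 'rV[int]_l),
        ~ lattice R n l x ->
        cot l k Z (x + latt R n m) u v = cot l k Z x u v &
      exists cot' : cylinder R n l -> cylinder R n l ->
                    'rV[R]_n -> 'rV[R]_n -> Cl R n,
        (forall x y u v : 'rV[R]_n, cyl_pi l x <> cyl_pi l y ->
           cot' (cyl_pi l x) (cyl_pi l y) u v = cot l k Z (x - y) u v) /\
        forall (y' : cylinder R n l) (v : 'rV[R]_n),
          [/\ forall x' : cylinder R n l, x' <> y' ->
                umonogenic_poly k.-1 (fun u => cot' x' y' u v),
              forall (x u : 'rV[R]_n) (j : 'I_n), cyl_pi l x <> y' ->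
                derivable (fun z => cot' (cyl_pi l z) y' u v) x (stdvec R n j) &
              forall (x' : cylinder R n l) (u : 'rV[R]_n), x' <> y' ->
                cylRSQ k (fun z' w => cot' z' y' w v) x' u = 0]].
Proof.
have mZ v := monogenic_kernel_section v Z_kernel.
have cE := cotE n_ge3 l_range Z_kernel.
have c'E := cot'_pi n_ge3 l_range Z_kernel.
split.
- by move=> u v K cK _; exact: cot_psum_uniform.
- by move=> x u v m _; exact: cot_translate.
exists (@cot' R n k l Z); split.
  move=> x y u v _; rewrite c'E; apply: (cot_eq n_ge3 l_range Z_kernel).
  rewrite opprB addrA [X in lattice _ _ _ X](_ : _ = - (repr (cyl_pi l y) - y)).
    have [m _ <-] := @lattice_repr R n l y; exists (- m) => //.
    by rewrite lattN.
  by rewrite opprB -[x - _ + y]addrA addrAC subrr add0r addrC.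
move=> y' v; pose y0 : 'rV[R]_n := repr y'.
have F z u : cot' k Z (cyl_pi l z) y' u v =
    clvec u * cotk l (kernel_section k Z v) (z - y0) u by rewrite c'E cE.
split.
- move=> x' _; exists (cotk l (kernel_section k Z v) (repr x' - y0)).
    exact: monogenic_cotk.
  by move=> u; rewrite /cot' cE.
- move=> x u j xy.
  have xl : ~ lattice R n l (x - y0).
    move=> /cyl_piP; rewrite {2}/cyl_pi reprK; exact: xy.
  under eq_fun do rewrite F.
  have [d _] := is_derive_cotk n_ge3 l_range (mZ v) u (stdvec R n j) xl.
  by have [] := cl_is_deriveM (is_derive_cst (clvec u) x (stdvec R n j)) (is_derive_translate d).
move=> x' u xy.
(* G has degree k - 1 in u, so D_x(u G) is in M_k; [fischerP] then returns it unchanged and the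
   difference defining Q_k vanishes. *)
have mD := monogenic_dirac_cotk n_ge3 l_range (mZ v) (not_latticeB xy).
rewrite prednK// in mD.
rewrite /cylRSQ /RSQ.
have Fu w : (fun y => cot' k Z (cyl_pi l y) y' w v) =
   (fun y => clvec w * cotk l (kernel_section k Z v) (y - y0) w).
  by apply/funext => y; exact: F.
have -> : (fun w => dirac (fun y => cot' k Z (cyl_pi l y) y' w v) (repr x')) =
   (fun w => dirac (fun y => clvec w * cotk l (kernel_section k Z v) (y - y0) w) (repr x')).
  by apply/funext => w; rewrite Fu.
rewrite Fu.
have := @fischerP_monogenic R n k.-1; rewrite prednK// => fP.
rewrite fP ?subrr//.
by move: n_ge3; clear; lia.
Qed.
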